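(* There exists a short exact sequence of Lie algebras $$0\to\ker(\mathfrak{g}^{\mathfrak m}\to\mathfrak{sdg})\to\ker(\mathfrak{bg}\to\mathfrak{eg})\to\ker(\mathfrak{sdg}\to\mathfrak{eg})\to0 .$$
   Context: $\mathfrak{g}^{\mathfrak m}$ is the motivic Lie algebra of mixed Tate motives over $\mathbb{Z}$, identified (by a fixed choice of generators) with the free Lie algebra $\mathrm{Lie}[\sigma_3,\sigma_5,\ldots]$ over $\mathbb{Q}$ with one generator $\sigma_{2k+1}$ for each $k\ge1$. Ihara bracket on polynomials: for $r\in\mathbb{Q}[z_0,z_1]$ and $q\in\mathbb{Q}[z_0,\ldots,z_{n-1}]$, $n\ge2$, $$\{r,q\}(z_0,\ldots,z_n)=\sum_{i=0}^n r(z_i,z_{i+1})\bigl(q(z_0,\ldots,\hat z_{i+1},\ldots,z_n)-q(z_0,\ldots,\hat z_i,\ldots,z_n)\bigr),$$ with indices modulo $n+1$ and $\hat z_j$ meaning that $z_j$ is omitted. $\mathfrak{bg}$, the block graded motivic Lie algebra, is identified with the Lie subalgebra $\mathfrak{rbg}$ of $\bigoplus_{n\ge1}\mathbb{Q}[z_0,\ldots,z_n]$ generated under this bracket by $$p_{2k+1}(z_0,z_1)=\frac{(2^{2k+1}-1)(z_0+z_1)^{2k}+(z_0-z_1)^{2k}}{2^{2k}},\quad k\ge1;$$ it is known to be freely generated by these elements, so $\sigma_{2k+1}\mapsto p_{2k+1}$ is an isomorphism $\mathfrak{g}^{\mathfrak m}\cong\mathfrak{bg}$. $\mathfrak{sdg}$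 is the Lie subalgebra of $\bigoplus_{n\ge1}\mathbb{Q}[z_0,\ldots,z_n]$ generated by $\phi_{2k+1}:=(z_0-z_1)^{2k}$, $k\ge1$, under the depth graded Ihara bracket $\{f,g\}=f\circ g-g\circ f$, where for $f\in\mathbb{Q}[z_0,\ldots,z_r]$, $g\in\mathbb{Q}[z_0,\ldots,z_s]$ $$(f\circ g)(z_0,\ldots,z_{r+s})=\sum_{i=0}^s f(z_i,\ldots,z_{i+r})g(z_0,\ldots,z_i,z_{i+r+1},\ldots,z_{r+s})+(-1)^{\deg f+r}\sum_{i=1}^s f(z_{i+r},\ldots,z_i)g(z_0,\ldots,z_{i-1},z_{i+r},\ldots,z_{r+s}).$$ $\pi_e$ is the linear projection of $\bigoplus_n\mathbb{Q}[z_0,\ldots,z_n]$ onto $\bigoplus_n\mathbb{Q}[z_0^2,\ldots,z_n^2]$ killing every monomial with some odd exponent. $\mathfrak{eg}$ is the Lie algebra generated by $e_{2k+1}:=\pi_e(p_{2k+1})=(z_0+z_1)^{2k}+(z_0-z_1)^{2k}$, $k\ge1$, under the same bracket as $\mathfrak{rbg}$. The maps: $\mathfrak{g}^{\mathfrak m}\to\mathfrak{sdg}$ is the Lie algebra homomorphism $\sigma_{2k+1}\mapsto\phi_{2k+1}$; $\mathfrak{bg}\to\mathfrak{eg}$ is $\pi_e$ ($p_{2k+1}\mapsto e_{2k+1}$); $\mathfrak{sdg}\to\mathfrak{eg}$ is the Lie algebra homomorphism with $\phi_{2k+1}\mapsto 2\pi_e(\phi_{2k+1})=e_{2k+1}$,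 i.e. $2^n\pi_e$ on the component in $\mathbb{Q}[z_0,\ldots,z_n]$ (its kernel equals that of $\pi_e$). *)

(* Defs.v *)
From HB Require Import structures.
From mathcomp Require Import all_boot all_order all_algebra.
From mathcomp Require Import boolp.
From mathcomp Require Import mpoly.
Set Implicit Arguments.
Unset Strict Implicit.
Unset Printing Implicit Defensive.
Import GRing.Theory.
Local Open Scope ring_scope.

(* A Lie algebra over Q is given by a Q-vector space V, an operation br on V
   and a subset S of V such that S is a subspace on which br restricts to a Lie
   bracket; nothing is required of br outside S.  Maps between such Lie
   algebras are functions on the ambient spaces, constrained on S only. *)

Definition whole (V : Type) : V -> Prop := fun=> True.

Section LieAlgebras.
Variables (V : lmodType rat) (br : V -> V -> V) (S : V -> Prop).

Definition is_subspace : Prop :=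
  S 0 /\ (forall (a : rat) u v, S u -> S v -> S (a *: u + v)).

Definition lie_algebra : Prop :=
  [/\ is_subspace,
      forall u v, S u -> S v -> S (br u v),
      forall (a : rat) u v w, S u -> S v -> S w ->
        br (a *: u + v) w = a *: br u w + br v w /\
        br w (a *: u + v) = a *: br w u + br w v,
      forall u, S u -> br u u = 0
    & forall u v w, S u -> S v -> S w ->
        br u (br v w) + br v (br w u) + br w (br u v) = 0].

(* The smallest subspace containing X and closed under br. *)
Inductive generated (X : V -> Prop) : V -> Prop :=
| generated_in u : X u -> generated X u
| generated_0 : generated X 0
| generated_lin (a : rat) u v :
    generated X u -> generated X v -> generated X (a *: u + v)
| generated_br u v :
    generated X u -> generated X v -> generated X (br u v).

End LieAlgebras.

Section LieMorphisms.
Variables (V W : lmodType rat) (brV : V -> V -> V) (brW : W -> W -> W).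

Definition lie_hom (S : V -> Prop) (T : W -> Prop) (f : V -> W) : Prop :=
  [/\ forall u, S u -> T (f u),
      forall (a : rat) u v, S u -> S v -> f (a *: u + v) = a *: f u + f v
    & forall u v, S u -> S v -> f (brV u v) = brW (f u) (f v)].

Definition injective_on (S : V -> Prop) (f : V -> W) : Prop :=
  forall u v, S u -> S v -> f u = f v -> u = v.

Definition surjective_on (S : V -> Prop) (T : W -> Prop) (f : V -> W) : Prop :=
  forall w, T w -> exists2 u, S u & f u = w.

Definition lie_iso (S : V -> Prop) (T : W -> Prop) (f : V -> W) : Prop :=
  [/\ lie_hom S T f, injective_on S f & surjective_on S T f].

Definition ker_on (S : V -> Prop) (f : V -> W) : V -> Prop :=
  fun u => S u /\ f u = 0.

End LieMorphisms.

(* The sequence 0 -> S1 -> S2 -> S3 -> 0, with maps a and b. *)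
Definition short_exact_lie (V1 V2 V3 : lmodType rat)
    (br1 : V1 -> V1 -> V1) (S1 : V1 -> Prop)
    (br2 : V2 -> V2 -> V2) (S2 : V2 -> Prop)
    (br3 : V3 -> V3 -> V3) (S3 : V3 -> Prop)
    (a : V1 -> V2) (b : V2 -> V3) : Prop :=
  [/\ [/\ lie_algebra br1 S1, lie_algebra br2 S2 & lie_algebra br3 S3],
      lie_hom br1 br2 S1 S2 a /\ lie_hom br2 br3 S2 S3 b,
      injective_on S1 a,
      forall v, S2 v -> (b v = 0 <-> exists2 u, S1 u & a u = v)
    & surjective_on S2 S3 b].

(* Universal property of the free Lie algebra on a countable family. *)
Definition free_lie_algebra (g : lmodType rat) (br : g -> g -> g)
    (sigma : nat -> g) : Prop :=
  lie_algebra br (@whole g) /\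
  forall (h : lmodType rat) (brh : h -> h -> h) (x : nat -> h),
    lie_algebra brh (@whole h) ->
    (exists f : g -> h, lie_hom br brh (@whole g) (@whole h) f /\
                        (forall k, f (sigma k) = x k)) /\
    (forall f f' : g -> h,
       lie_hom br brh (@whole g) (@whole h) f ->
       lie_hom br brh (@whole g) (@whole h) f' ->
       (forall k, f (sigma k) = f' (sigma k)) -> f =1 f').

(* Families (f_n) with f_n in Q[z_0, ..., z_n].  The direct sum over n >= 1 is
   the subspace of families of finite support with f_0 = 0.  The brackets below
   preserve it and ignore f_0, so that a subspace generated by elements of the
   direct sum lies in the direct sum. *)
Definition polyfam : Type := forall n : nat, {mpoly rat[n.+1]}.

Section PolyfamLmodule.

Let pf0 : polyfam := fun=> 0.
Let pfN (f : polyfam) : polyfam := fun n => - f n.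
Let pfD (f h : polyfam) : polyfam := fun n => f n + h n.
Let pfZ (a : rat) (f : polyfam) : polyfam := fun n => a *: f n.

Let pfDA : associative pfD.
Proof. by move=> f h k; apply: functional_extensionality_dep => n; exact: addrA. Qed.
Let pfDC : commutative pfD.
Proof. by move=> f h; apply: functional_extensionality_dep => n; exact: addrC. Qed.
Let pf0D : left_id pf0 pfD.
Proof. by move=> f; apply: functional_extensionality_dep => n; exact: add0r. Qed.
Let pfND : left_inverse pf0 pfN pfD.
Proof. by move=> f; apply: functional_extensionality_dep => n; exact: addNr. Qed.

HB.instance Definition _ := gen_eqMixin polyfam.
HB.instance Definition _ := gen_choiceMixin polyfam.
HB.instance Definition _ := GRing.isZmodule.Build polyfam pfDA pfDC pf0D pfND.

Let pfZA a b f : pfZ a (pfZ b f) = pfZ (a * b) f.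
Proof. by apply: functional_extensionality_dep => n; exact: scalerA. Qed.
Let pf1Z : left_id 1 pfZ.
Proof. by move=> f; apply: functional_extensionality_dep => n; exact: scale1r. Qed.
Let pfZDr : right_distributive pfZ +%R.
Proof. by move=> a f h; apply: functional_extensionality_dep => n; exact: scalerDr. Qed.
Let pfZDl f : {morph pfZ^~ f : a b / a + b}.
Proof. by move=> a b; apply: functional_extensionality_dep => n; exact: scalerDl. Qed.

HB.instance Definition _ :=
  GRing.Zmodule_isLmodule.Build rat polyfam pfZA pf1Z pfZDr pfZDl.

End PolyfamLmodule.

Definition in_depth1 (p : {mpoly rat[2]}) : polyfam :=
  fun n => match n return {mpoly rat[n.+1]} with 1 => p | _ => 0 end.

(* p(z_(s 0), ..., z_(s m)) as an element of Q[z_0, ..., z_N]. *)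
Definition subst (m N : nat) (p : {mpoly rat[m.+1]}) (s : nat -> 'I_N.+1) :
    {mpoly rat[N.+1]} :=
  p \mPo [tuple 'X_(s j) | j < m.+1].

Section IharaBracket.

Definition cyc (N i : nat) : 'I_N.+1 := inord (i %% N.+1).

(* The indices 0, ..., N in increasing order, those in A being omitted. *)
Definition omit (N : nat) (A : seq 'I_N.+1) (j : nat) : 'I_N.+1 :=
  nth ord0 [seq k <- enum 'I_N.+1 | k \notin A] j.

(* For r in Q[z_0, ..., z_m] and q in Q[z_0, ..., z_n], with N = m + n,
     {r,q}(z_0, ..., z_N) = sum_(0 <= i <= N) r(z_i, z_(i+1), ..., z_(i+m)) *
       (q(z_0, ..., z_N with z_(i+1), ..., z_(i+m) omitted)
        - q(z_0, ..., z_N with z_i, ..., z_(i+m-1) omitted)),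
   indices being taken modulo N + 1.  For m = 1 this is the formula given for
   r in Q[z_0, z_1]; for m > 1 it is the extension of that formula to a Lie
   bracket on cyclically invariant polynomials, so that on the
   Lie algebras generated in depth 1 below it is the only possible one. *)
Definition ihara (r q : polyfam) : polyfam := fun N =>
  \sum_(1 <= m < N) \sum_(i < N.+1)
    subst (r m) (fun j => cyc N (i + j)) *
    (subst (q (N - m)%N) (omit [seq cyc N (i + j) | j <- iota 1 m])
     - subst (q (N - m)%N) (omit [seq cyc N (i + j) | j <- iota 0 m])).

End IharaBracket.

Section DepthGradedIharaBracket.

(* (-1)^(deg f + r) f for f in Q[z_0, ..., z_r], extended linearly from
   homogeneous polynomials. *)
Definition sign_twist (r : nat) (f : {mpoly rat[r.+1]}) : {mpoly rat[r.+1]} :=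
  \sum_(d < msize f) (-1) ^+ (d + r) *: pihomog mdeg d f.

Definition dg_circ (f g : polyfam) : polyfam := fun N =>
  \sum_(1 <= r < N)
    (\sum_(0 <= i < (N - r).+1)
       subst (f r) (fun j => inord (i + j)) *
       subst (g (N - r)%N) (fun j => inord (if (j <= i)%N then j else j + r)%N)
   + \sum_(1 <= i < (N - r).+1)
       subst (sign_twist (f r)) (fun j => inord (i + r - j)) *
       subst (g (N - r)%N) (fun j => inord (if (j < i)%N then j else j + r)%N)).

Definition dg_ihara (f g : polyfam) : polyfam := dg_circ f g - dg_circ g f.

End DepthGradedIharaBracket.

(* Projection onto Q[z_0^2, ..., z_n^2]. *)
Definition even_part (n : nat) (f : {mpoly rat[n.+1]}) : {mpoly rat[n.+1]} :=
  \sum_(m <- msupp f | [forall i, ~~ odd (m i)]) f@_m *: 'X_[m].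

Definition pi_e (f : polyfam) : polyfam := fun n => even_part (f n).

(* The map sdg -> eg, equal to 2^n pi_e in Q[z_0, ..., z_n]. *)
Definition pi_sdg (f : polyfam) : polyfam := fun n => 2 ^+ n *: even_part (f n).

Notation z0 := ('X_ord0 : {mpoly rat[2]}).
Notation z1 := ('X_ord_max : {mpoly rat[2]}).

(* The generators p_(2k+1), phi_(2k+1) and e_(2k+1), meant for k >= 1. *)
Definition p_gen (k : nat) : polyfam := in_depth1
  ((2 ^+ k.*2)^-1 *: ((2 ^+ k.*2.+1 - 1) *: (z0 + z1) ^+ k.*2
                      + (z0 - z1) ^+ k.*2)).

Definition phi_gen (k : nat) : polyfam := in_depth1 ((z0 - z1) ^+ k.*2).

Definition e_gen (k : nat) : polyfam :=
  in_depth1 ((z0 + z1) ^+ k.*2 + (z0 - z1) ^+ k.*2).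

Definition rbg : polyfam -> Prop :=
  generated ihara (fun v => exists2 k, (1 <= k)%N & v = p_gen k).

Definition sdg : polyfam -> Prop :=
  generated dg_ihara (fun v => exists2 k, (1 <= k)%N & v = phi_gen k).

Definition eg : polyfam -> Prop :=
  generated ihara (fun v => exists2 k, (1 <= k)%N & v = e_gen k).

(* Main.v *)
(* With z_0^(a_0) ... z_n^(a_n) read as the word z^(a_0) x ... x z^(a_n), both
   brackets are one and the same bracket: let D_f be the derivation of Q<x,z>
   with z |-> [z,f] and x |-> 0; then {f,g} = D_f g - D_g f + [f,g].  It agrees
   with the block graded bracket on cyclically invariant elements, and with the
   depth graded one on the elements of even degree that reversal of the
   variables multiplies by (-1)^(n+1).  Since [D_f,D_g] = D_{f,g} and f can be
   recovered from D_f z, this is a Lie bracket.  On elements of even degree, pi_e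
   is a homomorphism, so pi_e o iota = pi_sdg o rho on the free Lie algebra
   because both sides agree on the generators; exactness is then diagram chasing.

   That iota is injective means that the p_(2k+1) generate a free Lie algebra.
   Their operators act on Q<x,z>, and it suffices that the elements
   D_(k_1) ... D_(k_n) z are linearly independent: by Dynkin's argument the free
   Lie algebra embeds in the free associative algebra.  After rescaling, p_(2k+1)
   has integral coefficients and is modulo 2 the sum of the terms with both
   exponents odd; the coefficient of z_0 z_1^(2 k'_1) ... z_n^(2 k'_n) in
   D_(k_1) ... D_(k_n) z is then unitriangular modulo 2 for the lexicographic
   order, because only one term of each operator contributes to it. *)

Require Import Defs.
From HB Require Import structures.
From mathcomp Require Import all_boot all_order all_algebra.
From mathcomp Require Import boolp.
From mathcomp Require Import -(notations) monalg.
From mathcomp Require Import mpoly ring zify.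
Set Implicit Arguments.
Unset Strict Implicit.
Unset Printing Implicit Defensive.
Import GRing.Theory.
Local Open Scope ring_scope.

(** The components of a family lie in different polynomial rings, and both brackets evaluate them at
    sublists of the variables. They are therefore studied as functions on words of variables: a
    bracket becomes a sum over cuts of a word, and coassociativity of deconcatenation replaces index
    arithmetic.

    Two conditions are carried along. The component in Q[z_0] must vanish, because [f] is recovered
    from D_f z = f (z_0 - z_n), which says nothing for n = 0. The degree must be even, for two
    separate reasons: the sign (-1)^(deg f) of the depth graded bracket disappears, and [pi_e]
    becomes multiplicative on products whose factors share a single variable, the only products in
    the bracket.

    Reduction modulo 2 isolates a leading monomial for the following reason: each operator
    multiplies by odd powers of two adjacent variables and leaves one of the two out of the other
    factor, so that, away from the front, every term has an odd exponent where the chosen monomial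
    has an even one. *)

(** * Sums over the factorizations of a word *)

Section Deconcatenation.
Variables (T : Type) (V : nmodType).
Implicit Types (s u v t : seq T) (phi : seq T -> seq T -> V).

(* The sum of phi u v over all factorizations s = u ++ v. *)
Fixpoint dec s phi : V :=
  phi [::] s + if s is a :: s' then dec s' (fun u v => phi (a :: u) v) else 0.

Lemma eq_dec s phi psi :
  (forall u v, u ++ v = s -> phi u v = psi u v) -> dec s phi = dec s psi.
Proof.
elim: s phi psi => [|a s IHs] phi psi eq_phi /=; first by rewrite eq_phi.
by rewrite eq_phi //; congr (_ + _); apply: IHs => u v E; apply: eq_phi; rewrite -E.
Qed.

Lemma dec0 s : dec s (fun _ _ => 0) = 0.
Proof. by elim: s => [|a s IHs] /=; rewrite ?IHs addr0. Qed.

Lemma decD s phi psi :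
  dec s (fun u v => phi u v + psi u v) = dec s phi + dec s psi.
Proof.
by elim: s phi psi => [|a s IHs] phi psi /=; rewrite ?addr0 // IHs addrACA.
Qed.

(** Coassociativity of deconcatenation: both sides run over the factorizations of [s] into three
    factors. *)
Lemma decA s (phi : seq T -> seq T -> seq T -> V) :
  dec s (fun u r => dec r (fun v t => phi u v t)) =
  dec s (fun p t => dec p (fun u v => phi u v t)).
Proof.
elim: s phi => [|a s IHs] phi //=.
by rewrite IHs addr0 decD addrA.
Qed.

Lemma dec_cat x y phi :
  dec (x ++ y) phi + phi x y =
  dec x (fun u w => phi u (w ++ y)) + dec y (fun u w => phi (x ++ u) w).
Proof.
elim: x phi => [|a x IHx] phi /=; first by rewrite addr0 addrC.
by rewrite -addrA IHx !addrA.
Qed.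

(* A nonempty factor may be cut off together with the letter on its right or
   with the letter on its left. *)
Lemma dec_rcons s (psi : seq T -> T -> seq T -> V) :
  dec s (fun w y => if y is a :: x then psi w a x else 0) =
  if s is b :: s' then
    dec s' (fun v t => psi (belast b v) (last b v) t)
  else 0.
Proof.
case: s => [|b s] /=; first by rewrite addr0.
elim: s b psi => [|c s IHs] b psi /=; first by rewrite !addr0.
congr (_ + _).
by rewrite (IHs c (fun w => psi (b :: w))).
Qed.

Lemma dec_sum s phi :
  dec s phi = \sum_(i < (size s).+1) phi (take i s) (drop i s).
Proof.
elim: s phi => [|a s IHs] phi /=; first by rewrite big_ord1 addr0.
by rewrite big_ord_recl IHs.
Qed.

Lemma dec_nil2 s (psi : seq T -> V) :
  dec s (fun u v => if v is [::] then psi u else 0) = psi s.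
Proof. by elim: s psi => [|a s IHs] psi /=; rewrite ?addr0 ?add0r ?IHs. Qed.

End Deconcatenation.

Lemma dec_morph (T : Type) (V W : nmodType) (f : {additive V -> W}) (s : seq T) phi :
  f (dec s phi) = dec s (fun u v => f (phi u v)).
Proof.
by elim: s phi => [|a s IHs] phi /=; rewrite raddfD ?IHs ?raddf0.
Qed.

Lemma decB (T : Type) (V : zmodType) (s : seq T) (phi psi : seq T -> seq T -> V) :
  dec s (fun u v => phi u v - psi u v) = dec s phi - dec s psi.
Proof.
rewrite decD; congr (_ + _).
by rewrite (dec_morph (@GRing.opp V)).
Qed.

Lemma dec_map (T U : Type) (V : nmodType) (g : T -> U) s
    (phi : seq U -> seq U -> V) :
  dec (map g s) phi = dec s (fun u v => phi (map g u) (map g v)).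
Proof.
by elim: s phi => [|a s IHs] phi //=; rewrite IHs.
Qed.

Lemma mulr_decl (T : Type) (R : comNzRingType) (c : R) (s : seq T) phi :
  c * dec s phi = dec s (fun u v => c * phi u v).
Proof.
elim: s phi => [|a s IHs] phi /=; first by rewrite !addr0.
by rewrite mulrDr IHs.
Qed.

(** * Derivations and the Ihara bracket on functions of words *)

Section IharaDerivation.
Variables (T : Type) (R : comNzRingType).
Implicit Types (F G H : seq T -> R) (s u v t r : seq T) (a b : T).

(* For s = z_0 ... z_N this is the sum over i <= j of
     F(z_i, ..., z_j) (G(z_0, ..., z_i, z_(j+1), ...) - G(..., z_(i-1), z_j, ...)).
   If the monomial z_0^(a_0) ... z_n^(a_n) stands for the noncommutative
   monomial z^(a_0) x z^(a_1) x ... x z^(a_n), then path_mul is the product and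
   der F is the derivation with z |-> z F - F z and x |-> 0. *)
Fixpoint der F G s : R :=
  if s is a :: s' then
    dec s' (fun v t => F (a :: v) * (G (a :: t) - G (last a v :: t)))
    + der F (fun r => G (a :: r)) s'
  else 0.

Definition path_mul F G s : R :=
  if s is a :: s' then dec s' (fun v t => F (a :: v) * G (last a v :: t))
  else 0.

Definition path_bracket F G s : R :=
  der F G s - der G F s + path_mul F G s - path_mul G F s.

Lemma eq_der F F' G G' s : F =1 F' -> G =1 G' -> der F G s = der F' G' s.
Proof.
move=> eqF; elim: s G G' => [|a s IHs] G G' eqG //=; congr (_ + _).
  by apply: eq_dec => v t _; rewrite eqF !eqG.
by apply: IHs.
Qed.

Lemma der_lin F F' G c s :
  der (fun r => c * F r + F' r) G s = c * der F G s + der F' G s.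
Proof.
elim: s G => [|a s IHs] G /=; first by rewrite mulr0 addr0.
rewrite IHs mulrDr mulr_decl addrACA -decD; congr (_ + _).
by apply: eq_dec => v t _; ring.
Qed.

Lemma der_linr F G G' c s :
  der F (fun r => c * G r + G' r) s = c * der F G s + der F G' s.
Proof.
elim: s G G' => [|a s IHs] G G' /=; first by rewrite mulr0 addr0.
rewrite (IHs (fun r => G (a :: r)) (fun r => G' (a :: r))).
rewrite mulrDr mulr_decl addrACA -decD; congr (_ + _).
by apply: eq_dec => v t _; ring.
Qed.

Lemma derD F G G' s : der F (fun r => G r + G' r) s = der F G s + der F G' s.
Proof.
rewrite -[der F G s]mul1r -der_linr; apply: eq_der => // r.
by rewrite mul1r.
Qed.

Lemma der0 F s : der F (fun=> 0) s = 0.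
Proof.
elim: s => //= a s ->; rewrite addr0 -[RHS](dec0 _ s).
by apply: eq_dec => v t _; rewrite subrr mulr0.
Qed.

Lemma der_scalel F G c s : der (fun r => c * F r) G s = c * der F G s.
Proof.
elim: s G => [|a s IHs] G /=; first by rewrite mulr0.
rewrite IHs mulrDr mulr_decl; congr (_ + _).
by apply: eq_dec => v t _; rewrite mulrA.
Qed.

Lemma der_mull F G c s : der F (fun r => c * G r) s = c * der F G s.
Proof.
rewrite -[RHS]addr0 -(der0 F s) -der_linr; apply: eq_der => // r.
by rewrite addr0.
Qed.

Lemma derB F G G' s : der F (fun r => G r - G' r) s = der F G s - der F G' s.
Proof.
rewrite -[- der F G' s]mulN1r -der_mull -derD; apply: eq_der => // r.
by rewrite mulN1r.
Qed.

(* Dually: der F is a derivation for concatenation. *)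
Lemma der_dec F s (psi : seq T -> seq T -> R) :
  der F (fun r => dec r psi) s =
  dec s (fun v t => der F (psi v) t + der F (psi^~ t) v).
Proof.
elim: s psi => [|a s IHs] psi /=; first by rewrite !addr0.
rewrite derD IHs.
set X := dec s (fun v t => F (a :: v) * _).
(* A cut of the shortened word either has an empty left factor or cuts [t]; in the second case
   [decA] turns the block and the cut of [t] into a block inside the left factor. *)
have -> : X = dec s (fun v t =>
      F (a :: v) * (psi [::] (a :: t) - psi [::] (last a v :: t)))
    + dec s (fun v t => dec v (fun v1 v2 =>
      F (a :: v1) * (psi (a :: v2) t - psi (last a v1 :: v2) t))).
  rewrite -decA -decD; apply: eq_dec => v t _.
  by rewrite -mulr_decl -mulrDr decB; congr (_ * _); ring.
rewrite addr0 !decD; ring.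
Qed.

(* Correction needed because the last letter of a word may be replaced. *)
Lemma der_last F G (k : T -> R) a s :
  der F (fun r => G r * k (last a r)) s
    + G [::] * F (a :: s) * (k a - k (last a s)) =
  der F G s * k (last a s)
    + dec s (fun u w => G u * F (last a u :: w) * (k (last a u) - k (last a s))).
Proof.
elim: s a G => [|b s IHs] a G /=; first by rewrite subrr; ring.
have /(canRL (addrK _)) -> := IHs b (fun r => G (b :: r)).
set X := dec s _.
(* Only the block that runs to the end of the word, with [t] empty, can change the last letter; it
   yields the extra summand. *)
have -> : X = dec s (fun v t => F (b :: v) * (G (b :: t) - G (last b v :: t)))
     * k (last b s) + G [:: b] * F (b :: s) * (k b - k (last b s)).
  rewrite mulrC mulr_decl -[G [:: b] * F _ * _](dec_nil2 s
    (fun u => G [:: b] * F (b :: u) * (k b - k (last b u)))) -decD.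
  apply: eq_dec => v t <-; rewrite last_cat.
  by case: t => [|c t] /=; ring.
ring.
Qed.

(** Terms in which [F] and [G] act on separate blocks are the same in both orders and cancel. Where
    the blocks meet, both lie in one factor of the word, on which they add up to the bracket.
    Vanishing on single letters removes the boundary term of [der_last]. *)
Lemma der_bracket F G H s :
  (forall a, F [:: a] = 0) -> (forall a, G [:: a] = 0) ->
  der F (der G H) s - der G (der F H) s = der (path_bracket F G) H s.
Proof.
move=> F1 G1; elim: s H => [|a s IHs] H /=; first by rewrite subrr.
pose Q F G c r := dec r (fun v t => F (c :: v) * (G (c :: t) - G (last c v :: t))).
rewrite -IHs !derD.
(* [Q] collects the blocks that start at the first letter. The block of [E] lies in [t], apart from
   that of [E'], or in [v], where it may also change the letter that [E'] leaves in front of [t];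
   hence the use of [der_last]. *)
have derQ E E' : (forall a, E' [:: a] = 0) -> der E (Q E' H a) s =
   dec s (fun v t => E' (a :: v) * (der E (fun r => H (a :: r)) t
                                    - der E (fun r => H (last a v :: r)) t))
   + dec s (fun v t => der E (fun r => E' (a :: r)) v * (H (a :: t) - H (last a v :: t))
   + dec v (fun u w => E' (a :: u) * E (last a u :: w) *
       (H (last a v :: t) - H (last a u :: t)))).
  move=> E'1; rewrite der_dec decD; congr (_ + _).
    by apply: eq_dec => v t _; rewrite der_mull derB.
  apply: eq_dec => v t _.
  have := der_last E (fun r => E' (a :: r)) (fun c => H (a :: t) - H (c :: t)) a v.
  rewrite E'1 !mul0r addr0 => ->; congr (_ + _).
  by apply: eq_dec => u w _; ring.
have expand E E' : (forall a, E' [:: a] = 0) ->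
    dec s (fun v t => E (a :: v) * (der E' H (a :: t) - der E' H (last a v :: t)))
    = dec s (fun v t => E (a :: v) * (der E' (fun r => H (a :: r)) t
                                      - der E' (fun r => H (last a v :: r)) t))
    + dec s (fun p t => dec p (fun u w => E (a :: u) *
       (E' (a :: w) * (H (a :: t) - H (last a p :: t))
        - E' (last a u :: w) * (H (last a u :: t) - H (last a p :: t))))).
  move=> E'1.
  have -> : dec s (fun p t => dec p (fun u w => E (a :: u) *
       (E' (a :: w) * (H (a :: t) - H (last a p :: t))
        - E' (last a u :: w) * (H (last a u :: t) - H (last a p :: t))))) =
    dec s (fun p t => dec p (fun u w => E (a :: u) *
       (E' (a :: w) * (H (a :: t) - H (last a w :: t))
        - E' (last a u :: w) * (H (last a u :: t) - H (last (last a u) w :: t))))).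
    apply: eq_dec => p t _; apply: eq_dec => u w <-; rewrite last_cat.
    by case: w => [|c w] //=; rewrite E'1 !mul0r.
  rewrite -decA -decD; apply: eq_dec => v t _ /=.
  by rewrite -mulr_decl -mulrDr decB; congr (_ * _); ring.
rewrite (expand F G G1) (expand G F F1) (derQ F G G1) (derQ G F F1) {expand derQ}.
set X := dec s (fun v t => path_bracket F G _ * _).
pose M E E' := dec s (fun p t => dec p (fun u w => E (a :: u) *
       (E' (a :: w) * (H (a :: t) - H (last a p :: t))
        - E' (last a u :: w) * (H (last a u :: t) - H (last a p :: t))))).
pose N E E' := dec s (fun v t => der E (fun r => E' (a :: r)) v * (H (a :: t) - H (last a v :: t))
   + dec v (fun u w => E' (a :: u) * E (last a u :: w) *
       (H (last a v :: t) - H (last a u :: t)))).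
(* [M] and [N] hold the terms whose blocks meet. The separate ones of [expand F G] cancel those of
   [derQ G F], and likewise with [F] and [G] exchanged. *)
suff -> : X = M F G + N F G - M G F - N G F by rewrite /M /N; ring.
rewrite -!decD -!decB; apply: eq_dec => p t _.
rewrite /path_bracket /=; set Y := H _ - _.
rewrite ![_ * Y]mulrC !(mulrDr, mulrN) !mulr_decl.
have split4 (A B C D : seq T -> seq T -> R) :
  dec p A + dec p B - dec p C - dec p D
  = dec p (fun u w => A u w + B u w - C u w - D u w).
  by rewrite -decD -!decB.
pose d := der F (fun r => G (a :: r)) p * Y - der G (fun r => F (a :: r)) p * Y.
transitivity (d + dec p (fun u w =>
    Y * (F (a :: u) * (G (a :: w) - G (last a u :: w)))
  + Y * (F (a :: u) * G (last a u :: w))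
  - Y * (G (a :: u) * (F (a :: w) - F (last a u :: w)))
  - Y * (G (a :: u) * F (last a u :: w)))).
  by rewrite -split4 /d; ring.
transitivity (d + dec p (fun u w => F (a :: u) *
       (G (a :: w) * Y
        - G (last a u :: w) * (H (last a u :: t) - H (last a p :: t)))
  + G (a :: u) * F (last a u :: w) * (H (last a p :: t) - H (last a u :: t))
  - G (a :: u) * (F (a :: w) * Y
        - F (last a u :: w) * (H (last a u :: t) - H (last a p :: t)))
  - F (a :: u) * G (last a u :: w) * (H (last a p :: t) - H (last a u :: t)))).
  by congr (_ + _); apply: eq_dec => u w _; ring.
by rewrite -split4 /d; ring.
Qed.

End IharaDerivation.

Lemma dec_behead (T : Type) (V : nmodType) (s : seq T) (phi : seq T -> seq T -> V) :
  dec s phi = phi [::] s + dec s (fun u v => if u is _ :: _ then phi u v else 0).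
Proof. by case: s => [|a s] /=; rewrite ?addr0 ?add0r. Qed.

Lemma dec_rev (T : Type) (V : nmodType) (s : seq T) (phi : seq T -> seq T -> V) :
  dec (rev s) phi = dec s (fun u v => phi (rev v) (rev u)).
Proof.
elim: s phi => [|a s IHs] phi //=.
rewrite rev_cons -cats1.
have -> : dec (rev s ++ [:: a]) phi =
    dec (rev s) (fun u w => phi u (w ++ [:: a])) + phi (rcons (rev s) a) [::].
  elim: (rev s) phi => [|b r IHr] phi /=; first by rewrite !addr0.
  by rewrite IHr addrA.
rewrite addrC IHs -rev_cons; congr (_ + _); first by rewrite cats1 rev_cons.
apply: eq_dec => u v _.
by rewrite cats1 -rev_cons.
Qed.

(** * Behaviour of the bracket under reversal and rotation of words *)

Section BracketSymmetries.
Variables (T : Type) (R : comNzRingType).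
Implicit Types (F G : seq T -> R) (s u v t w : seq T).

Definition der_term F G u w t : R :=
  if w is a :: v then F w * (G (u ++ a :: t) - G (u ++ last a v :: t)) else 0.

(** Unrolls the recursion into a sum over factorizations into prefix, block and suffix, a form that
    reversal and rotation can act on. *)
Lemma der_expand F G s :
  der F G s = dec s (fun u r => dec r (fun w t => der_term F G u w t)).
Proof.
elim: s G => [|a s IHs] G /=; first by rewrite !addr0.
by rewrite add0r IHs.
Qed.

Lemma der_expand' F G s :
  der F G s = dec s (fun u r => if r is a :: r' then
    dec r' (fun v t => F (a :: v) * (G (u ++ a :: t) - G (u ++ last a v :: t)))
  else 0).
Proof.
rewrite der_expand; apply: eq_dec => u [|a r] _ /=; by rewrite ?addr0 ?add0r.
Qed.

Lemma path_mul_expand F G s :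
  path_mul F G s =
  dec s (fun u r => if r is c :: t then F (rcons u c) * G (c :: t) else 0).
Proof.
rewrite (dec_rcons _ (fun u c t => F (rcons u c) * G (c :: t))).
by case: s => [|b s] //=; apply: eq_dec => v t _; rewrite -lastI.
Qed.

Lemma path_bracketC F G s : path_bracket G F s = - path_bracket F G s.
Proof. by rewrite /path_bracket; ring. Qed.

Lemma path_mul_lin F F' G c s :
  path_mul (fun r => c * F r + F' r) G s = c * path_mul F G s + path_mul F' G s.
Proof.
case: s => [|a s] /=; first by ring.
by rewrite mulr_decl -decD; apply: eq_dec => v t _; ring.
Qed.

Lemma path_mul_linr F G G' c s :
  path_mul F (fun r => c * G r + G' r) s = c * path_mul F G s + path_mul F G' s.
Proof.
case: s => [|a s] /=; first by ring.
by rewrite mulr_decl -decD; apply: eq_dec => v t _; ring.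
Qed.

Lemma path_bracket_lin F F' G c s :
  path_bracket (fun r => c * F r + F' r) G s =
  c * path_bracket F G s + path_bracket F' G s.
Proof.
by rewrite /path_bracket der_lin der_linr path_mul_lin path_mul_linr; ring.
Qed.

Lemma eq_path_bracket F F' G G' s :
  F =1 F' -> G =1 G' -> path_bracket F G s = path_bracket F' G' s.
Proof.
move=> eqF eqG; rewrite /path_bracket (eq_der s eqF eqG) (eq_der s eqG eqF).
case: s => [|a s] //=; congr (_ + _ - _); apply: eq_dec => v t _;
  by rewrite eqF eqG.
Qed.

Lemma path_bracket_singleton F G a :
  F [:: a] = 0 -> G [:: a] = 0 -> path_bracket F G [:: a] = 0.
Proof. by move=> F0 G0; rewrite /path_bracket /= F0 G0; ring. Qed.

(** Serves maps that are not ring morphisms, such as [even_part] and scalings: multiplicativity is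
    asked only for the products that occur in the bracket, a block times the word in which the block
    is replaced by its first or last letter. *)
Lemma path_bracket_additive (f : {additive R -> R}) F G F' G' s :
    (forall u a v t c, u ++ a :: v ++ t = s -> c = a \/ c = last a v ->
      f (F (a :: v) * G (u ++ c :: t)) = F' (a :: v) * G' (u ++ c :: t) /\
      f (G (a :: v) * F (u ++ c :: t)) = G' (a :: v) * F' (u ++ c :: t)) ->
  f (path_bracket F G s) = path_bracket F' G' s.
Proof.
move=> hyp.
have fder A B A' B' : (forall u a v t c, u ++ a :: v ++ t = s ->
    c = a \/ c = last a v ->
    f (A (a :: v) * B (u ++ c :: t)) = A' (a :: v) * B' (u ++ c :: t)) ->
  f (der A B s) = der A' B' s /\ f (path_mul A B s) = path_mul A' B' s.
  move=> hAB; split.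
    rewrite !der_expand dec_morph; apply: eq_dec => u r Er.
    rewrite dec_morph; apply: eq_dec => [[|a v]] t Evt /=; first by rewrite raddf0.
    have Es : u ++ a :: v ++ t = s by rewrite -Er -Evt.
    by rewrite !mulrBr raddfB /= (hAB _ _ _ _ a Es) ?(hAB _ _ _ _ _ Es); auto.
  case: (s) hAB => [|a s'] hAB /=; first by rewrite raddf0.
  rewrite dec_morph; apply: eq_dec => v t Evt.
  by apply: (hAB [::]); [rewrite /= Evt | right].
have [fFG mFG] := fder F G F' G' (fun u a v t c E H => (hyp u a v t c E H).1).
have [fGF mGF] := fder G F G' F' (fun u a v t c E H => (hyp u a v t c E H).2).
by rewrite /path_bracket !(raddfB, raddfD) /= fFG mFG fGF mGF.
Qed.

Definition skew_rev F := forall s, F (rev s) = (-1) ^+ size s * F s.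

(** The two factors have [(size s).+1] letters together, and reversal exchanges the ends of the
    block, hence the two terms of the difference: the two extra signs cancel. *)
Lemma der_rev F G s : skew_rev F -> skew_rev G ->
  der F G (rev s) = (-1) ^+ size s * der F G s.
Proof.
move=> Frev Grev; rewrite !der_expand dec_rev mulr_decl.
under eq_dec => u v _ do rewrite dec_rev.
rewrite -[LHS](decA s (fun u v t => der_term F G (rev t) (rev v) (rev u))).
apply: eq_dec => u r Er; rewrite mulr_decl; apply: eq_dec => w t Et.
case: w Et => [|a v] Et; first by rewrite /= mulr0.
have Gr x c y : G (rev y ++ c :: rev x) =
    (-1) ^+ (size x + size y).+1 * G (x ++ c :: y).
  rewrite -cat_rcons -rev_cons -rev_cat Grev size_cat /=.
  by rewrite addnS.
rewrite /der_term /= lastI rev_rcons /=.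
have -> : last (last a v) (rev (belast a v)) = a.
  by case: v {Et} => [|b v] //=; rewrite rev_cons last_rcons.
rewrite !Gr -rev_rcons Frev -lastI -Er size_cat -Et size_cat /=.
by rewrite !(exprS, exprD, addnS, addSn); ring.
Qed.

(** The letter shared by the factors is counted twice, whence the exponent; in the commutator this
    sign makes up for the exchange of [F] and [G]. *)
Lemma path_mul_rev F G s : skew_rev F -> skew_rev G ->
  path_mul F G (rev s) = (-1) ^+ (size s).+1 * path_mul G F s.
Proof.
move=> Frev Grev; rewrite path_mul_expand dec_rev.
case: s => [|a s] /=; first by rewrite addr0 mulr0.
rewrite add0r mulr_decl; apply: eq_dec => v t <-.
rewrite lastI rev_rcons -rev_cons -rev_rcons Frev Grev size_rcons size_belast.
by rewrite -lastI size_cat /= !(exprS, exprD); ring.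
Qed.

Lemma path_bracket_rev F G : skew_rev F -> skew_rev G ->
  skew_rev (path_bracket F G).
Proof.
move=> Frev Grev s; rewrite /path_bracket !der_rev // !path_mul_rev //.
by rewrite exprS; ring.
Qed.

Definition cyclic F := forall s t, F (s ++ t) = F (t ++ s).

Definition der_prefix F G s : R :=
  if s is a :: r then dec r (fun v t => F (a :: v) * (G (a :: t) - G (last a v :: t)))
  else 0.

(** Blocks of the rotated words that do not pass the end of [s] give [der F G]. For a block that
    passes it, cyclicity lets the interval left over act as a block of [G] inside the argument of
    [F]; such blocks give [- der G F] and the commutator. *)
Lemma path_bracket_cyclic F G s : cyclic F -> cyclic G ->
  path_bracket F G s = \sum_(i < size s) der_prefix F G (rot i s).
Proof.
move=> Fcyc Gcyc.
have -> : \sum_(i < size s) der_prefix F G (rot i s) =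
    dec s (fun u1 u2 => if u2 is a :: x then der_prefix F G (a :: x ++ u1) else 0).
  rewrite dec_sum big_ord_recr /= drop_size addr0; apply: eq_bigr => i _.
  rewrite /rot; case: (drop i s) (size_drop i s) => //= sz.
  by have := ltn_ord i; rewrite -subn_gt0 -sz.
pose S2 := dec s (fun u1 u2 => if u2 is a :: x then
    dec u1 (fun v w => if v is c :: v' then
       F (v ++ a :: x) * (G (rcons w a) - G (last c v' :: w)) else 0) else 0).
have -> : dec s (fun u1 u2 => if u2 is a :: x then der_prefix F G (a :: x ++ u1) else 0)
    = der F G s + S2.
  rewrite der_expand' -decD; apply: eq_dec => u1 [|a x] _ /=; first by rewrite addr0.
  have := dec_cat x u1 (fun v t => F (a :: v) * (G (a :: t) - G (last a v :: t))).
  move/(canRL (addrK _)) => ->.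
  rewrite [X in _ + X - _]dec_behead cats0 [_ * _ + _]addrC addrA addrK.
  congr (_ + _); apply: eq_dec => v w _.
    by rewrite -[a :: w ++ u1]cat_cons -[last a v :: w ++ u1]cat_cons !(Gcyc _ u1).
  case: v => [|c v] //; rewrite last_cat /= -cat_cons Fcyc /=.
  by rewrite -(cats1 w) (Gcyc w).
(* As [v] is nonempty, the blocks of [G] at the very beginning of the word are missing; their sum is
   [path_mul G F]. *)
have S2a : dec s (fun v r => if v is _ :: _ then dec r (fun w y =>
      if y is a :: x then F (v ++ a :: x) * G (rcons w a) else 0) else 0)
    = dec s (fun v r => if r is b :: r' then
        dec r' (fun v' t => G (b :: v') * F (v ++ last b v' :: t)) else 0)
      - path_mul G F s.
  apply/(canRL (addrK _)); rewrite [RHS]dec_behead addrC; congr (_ + _).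
  apply: eq_dec => [[|c v]] r _ //.
  rewrite (dec_rcons r (fun w a x => F ((c :: v) ++ a :: x) * G (rcons w a))).
  case: r => [|b r] //; apply: eq_dec => v' t _; by rewrite -lastI mulrC.
(* Here the blocks of [G] that reach the end of the word are missing; their sum is
   [path_mul F G]. *)
have S2b : dec s (fun v r => if v is c :: v' then dec r (fun w y =>
      if y is a :: x then F (v ++ a :: x) * G (last c v' :: w) else 0) else 0)
    = dec s (fun v r => if r is b :: r' then
        dec r' (fun v' t => G (b :: v') * F (v ++ b :: t)) else 0)
      - path_mul F G s.
  apply/(canRL (addrK _)); rewrite path_mul_expand.
  have -> : dec s (fun v r => if v is c :: v' then dec r (fun w y =>
      if y is a :: x then F (v ++ a :: x) * G (last c v' :: w) else 0) else 0)
    = dec s (fun u r0 => if r0 is c :: r then dec r (fun w y =>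
      if y is a :: x then F (u ++ c :: a :: x) * G (c :: w) else 0) else 0).
    rewrite (dec_rcons s (fun u c r => dec r (fun w y =>
      if y is a :: x then F (u ++ c :: a :: x) * G (c :: w) else 0))).
    case: (s) => [|b s'] /=; first by rewrite addr0.
    rewrite add0r; apply: eq_dec => v r _; apply: eq_dec => w [|a x] _ //.
    by rewrite -(cat_rcons (last b v)) -lastI.
  rewrite -decD; apply: eq_dec => u [|c r] _; first by rewrite addr0.
  rewrite -cats1 [_ * _]mulrC.
  rewrite -(dec_nil2 r (fun w => G (c :: w) * F (u ++ [:: c]))) -decD.
  by apply: eq_dec => w [|a x] _; rewrite ?add0r // addr0 mulrC.
have -> : S2 = dec s (fun v r => if v is _ :: _ then dec r (fun w y =>
      if y is a :: x then F (v ++ a :: x) * G (rcons w a) else 0) else 0)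
   - dec s (fun v r => if v is c :: v' then dec r (fun w y =>
      if y is a :: x then F (v ++ a :: x) * G (last c v' :: w) else 0) else 0).
  rewrite -decB.
  transitivity (dec s (fun v r => dec r (fun w y => if y is a :: x then
     if v is c :: v' then F (v ++ a :: x) * (G (rcons w a) - G (last c v' :: w))
     else 0 else 0))).
    rewrite decA; apply: eq_dec => u1 [|a x] _ //.
    by rewrite dec0.
  apply: eq_dec => [[|c v]] r _.
    rewrite subrr -[RHS](dec0 _ r); by apply: eq_dec => w [].
  by rewrite -decB; apply: eq_dec => w [|a x] _; rewrite ?subrr ?mulrBr.
rewrite S2a S2b /path_bracket.
have -> : der G F s = dec s (fun v r => if r is b :: r' then
        dec r' (fun v' t => G (b :: v') * F (v ++ b :: t)) else 0)
    - dec s (fun v r => if r is b :: r' then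
        dec r' (fun v' t => G (b :: v') * F (v ++ last b v' :: t)) else 0).
  rewrite der_expand' -decB; apply: eq_dec => u [|b r] _; first by rewrite subrr.
  by rewrite -decB; apply: eq_dec => v t _; rewrite mulrBr.
by ring.
Qed.

(** In the form of [path_bracket_cyclic] a rotation only shifts the summation index, and the shift
    telescopes over a full turn. *)
Lemma cyclic_path_bracket F G : cyclic F -> cyclic G -> cyclic (path_bracket F G).
Proof.
move=> Fcyc Gcyc.
have rot1 s : path_bracket F G (rot 1 s) = path_bracket F G s.
  rewrite !path_bracket_cyclic // size_rot.
  apply/eqP; rewrite -subr_eq0; apply/eqP.
  have -> : \sum_(i < size s) der_prefix F G (rot i (rot 1 s)) =
            \sum_(i < size s) der_prefix F G (rot i.+1 s).
    by apply: eq_bigr => i _; rewrite -rotD // addn1.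
  rewrite -sumrB -(big_mkord predT (fun i => der_prefix F G (rot i.+1 s) - der_prefix F G (rot i s))).
  by rewrite telescope_sumr // rot_size rot0 subrr.
have rotk k s : (k <= size s)%N -> path_bracket F G (rot k s) = path_bracket F G s.
  elim: k => [|k IHk] ks; first by rewrite rot0.
  by rewrite rotS // rot1 IHk // ltnW.
move=> s t; rewrite -(rot_size_cat s t) rotk // size_cat leq_addr //.
Qed.

End BracketSymmetries.

Section BracketMorphism.
Variables (T U : Type) (R S : comNzRingType) (f : {rmorphism R -> S}) (g : T -> U).
Variables (F G : seq T -> R) (F' G' : seq U -> S).
Hypothesis FF' : forall s, f (F s) = F' (map g s).

Lemma der_morph s : (forall s, f (G s) = G' (map g s)) ->
  f (der F G s) = der F' G' (map g s).
Proof.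
elim: s G G' => [|a s IHs] H H' HH' /=; first by rewrite raddf0.
rewrite raddfD /= dec_morph dec_map (IHs _ (fun r => H' (g a :: r))) //.
congr (_ + _); apply: eq_dec => v t _.
by rewrite /= rmorphM raddfB /= FF' !HH' /= last_map.
Qed.

Lemma path_mul_morph s : (forall s, f (G s) = G' (map g s)) ->
  f (path_mul F G s) = path_mul F' G' (map g s).
Proof.
move=> HH'; case: s => [|a s] /=; first by rewrite raddf0.
rewrite dec_morph dec_map; apply: eq_dec => v t _.
by rewrite /= rmorphM FF' HH' /= last_map.
Qed.
End BracketMorphism.

Lemma path_bracket_morph (T U : Type) (R S : comNzRingType)
    (f : {rmorphism R -> S}) (g : T -> U) F G F' G' s :
  (forall s, f (F s) = F' (map g s)) -> (forall s, f (G s) = G' (map g s)) ->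
  f (path_bracket F G s) = path_bracket F' G' (map g s).
Proof.
move=> FF' GG'; rewrite /path_bracket !(raddfB, raddfD) /=.
rewrite (der_morph FF' s GG') (der_morph GG' s FF').
by rewrite (path_mul_morph FF' s GG') (path_mul_morph GG' s FF').
Qed.

(** * Families of polynomials *)

(* The value of the component of f with size s variables at the variables
   listed in s. *)
Definition at_vars (N : nat) (f : polyfam) (s : seq 'I_N.+1) :
    {mpoly rat[N.+1]} :=
  if s is a :: s' then subst (f (size s')) (nth a s) else 0.

Lemma polyfamP (f g : polyfam) : (forall n, f n = g n) -> f = g.
Proof. exact: functional_extensionality_dep. Qed.

Lemma polyfamDE (f g : polyfam) n : (f + g) n = f n + g n.
Proof. by []. Qed.

Lemma polyfamNE (f : polyfam) n : (- f) n = - f n.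
Proof. by []. Qed.

Lemma polyfamZE a (f : polyfam) n : (a *: f) n = a *: f n.
Proof. by []. Qed.

Lemma eq_subst m N (p : {mpoly rat[m.+1]}) (h h' : nat -> 'I_N.+1) :
  (forall j, (j < m.+1)%N -> h j = h' j) -> subst p h = subst p h'.
Proof.
move=> eqh; rewrite /subst; congr (_ \mPo _); apply: eq_from_tnth => j.
by rewrite !tnth_mktuple eqh.
Qed.

Lemma at_varsE N f (s : seq 'I_N.+1) m x :
  size s = m.+1 -> at_vars f s = subst (f m) (nth x s).
Proof.
case: s => //= a s [<-]; apply: eq_subst => j lt_j.
exact: set_nth_default.
Qed.

Lemma at_vars_mkseq N f (h : nat -> 'I_N.+1) m :
  at_vars f (mkseq h m.+1) = subst (f m) h.
Proof.
rewrite (@at_varsE _ _ _ m ord0) ?size_mkseq //; apply: eq_subst => j lt_j.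
by rewrite nth_mkseq.
Qed.

Lemma enum_mkseq N : enum 'I_N.+1 = mkseq inord N.+1.
Proof.
apply: (@eq_from_nth _ ord0); rewrite size_enum_ord ?size_mkseq // => i lt_i.
by rewrite nth_mkseq //; apply: val_inj; rewrite /= inordK // nth_enum_ord.
Qed.

Lemma at_vars_enum n f : at_vars f (enum 'I_n.+1) = f n.
Proof.
rewrite (@at_varsE _ _ _ n ord0) ?size_enum_ord // -[RHS]comp_mpoly_id.
rewrite /subst; congr (_ \mPo _); apply: eq_from_tnth => j.
by rewrite !tnth_mktuple nth_ord_enum.
Qed.

Definition rename n N (h : 'I_n.+1 -> 'I_N.+1) :
    {mpoly rat[n.+1]} -> {mpoly rat[N.+1]} :=
  comp_mpoly [tuple 'X_(h i) | i < n.+1].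

HB.instance Definition _ n N h := GRing.LRMorphism.on (@rename n N h).

Lemma renameZ n N (h : 'I_n.+1 -> 'I_N.+1) a p : rename h (a *: p) = a *: rename h p.
Proof. exact: comp_mpolyZ. Qed.

Lemma renameX n N (h : 'I_n.+1 -> 'I_N.+1) i : rename h 'X_i = 'X_(h i).
Proof. by rewrite /rename comp_mpolyXU -tnth_nth tnth_mktuple. Qed.

Lemma rename_subst m n N (h : 'I_n.+1 -> 'I_N.+1) (p : {mpoly rat[m.+1]}) k :
  rename h (subst p k) = subst p (h \o k).
Proof.
rewrite /subst [p \mPo _]comp_mpolyE [RHS]comp_mpolyE raddf_sum /=.
apply: eq_bigr => a _; rewrite linearZ rmorph_prod /=; congr (_ *: _).
apply: eq_bigr => i _; rewrite rmorphXn /= !tnth_mktuple.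
by rewrite renameX.
Qed.

Lemma rename_at_vars n N (h : 'I_n.+1 -> 'I_N.+1) f s :
  rename h (at_vars f s) = at_vars f (map h s).
Proof.
case: s => [|a s] /=; first by rewrite raddf0.
rewrite rename_subst size_map; apply: eq_subst => j lt_j /=.
by rewrite -[h a :: _]/(map h (a :: s)) (nth_map a).
Qed.

Lemma subst_rename m N (p : {mpoly rat[m.+1]}) (h : nat -> 'I_N.+1) :
  subst p h = rename h p.
Proof. by []. Qed.

Lemma map_nth_enum N (a : 'I_N.+1) (s : seq 'I_N.+1) n :
  size s = n.+1 -> [seq nth a s i | i : 'I_n.+1 <- enum 'I_n.+1] = s.
Proof.
move=> sz; apply: (@eq_from_nth _ a); rewrite size_map size_enum_ord ?sz //.
by move=> i lt_i; rewrite (nth_map ord0) ?size_enum_ord // nth_enum_ord.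
Qed.

(** Locked against unfolding during unification; [pderE] gives access to the components. *)
HB.lock Definition pder (f g : polyfam) : polyfam :=
  fun n => der (at_vars f) (at_vars g) (enum 'I_n.+1).

HB.lock Definition pbracket (f g : polyfam) : polyfam :=
  fun n => path_bracket (at_vars f) (at_vars g) (enum 'I_n.+1).

Lemma pderE f g n : pder f g n = der (at_vars f) (at_vars g) (enum 'I_n.+1).
Proof. by rewrite pder.unlock. Qed.

Lemma pbracketE f g n :
  pbracket f g n = path_bracket (at_vars f) (at_vars g) (enum 'I_n.+1).
Proof. by rewrite pbracket.unlock. Qed.

(** Since [der] commutes with renaming of variables, what holds at the generic list holds at every
    list, repetitions included. This allows [pder] to be iterated. *)
Lemma at_vars_der N f g (s : seq 'I_N.+1) :
  at_vars (pder f g) s = der (at_vars f) (at_vars g) s.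
Proof.
case: s => // a s; rewrite /at_vars subst_rename !pderE.
rewrite (der_morph (fun s => rename_at_vars _ f s) _
                   (fun s => rename_at_vars _ g s)).
by rewrite map_nth_enum.
Qed.

Lemma at_vars_bracket N f g (s : seq 'I_N.+1) :
  at_vars (pbracket f g) s = path_bracket (at_vars f) (at_vars g) s.
Proof.
case: s => [|a s]; first by rewrite /path_bracket /=; ring.
rewrite {1}/at_vars subst_rename !pbracketE.
rewrite (path_bracket_morph _ (fun s => rename_at_vars _ f s)
                   (fun s => rename_at_vars _ g s)).
by rewrite map_nth_enum.
Qed.

Lemma at_vars_lin N (a : rat) f g (s : seq 'I_N.+1) :
  at_vars (a *: f + g) s = a%:MP * at_vars f s + at_vars g s.
Proof.
case: s => [|b s] /=; first by rewrite mulr0 addr0.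
by rewrite !subst_rename raddfD /= mul_mpolyC -linearZ.
Qed.

Lemma pbracket_lin (a : rat) f f' g :
  pbracket (a *: f + f') g = a *: pbracket f g + pbracket f' g.
Proof.
apply: polyfamP => n; rewrite polyfamDE polyfamZE !pbracketE.
rewrite (eq_path_bracket _ (at_vars_lin a f f') (frefl _)) path_bracket_lin.
by rewrite mul_mpolyC.
Qed.

Lemma pbracketC f g : pbracket g f = - pbracket f g.
Proof. by apply: polyfamP => n; rewrite polyfamNE !pbracketE path_bracketC. Qed.

Lemma pbracket_linr (a : rat) f f' g :
  pbracket g (a *: f + f') = a *: pbracket g f + pbracket g f'.
Proof.
by rewrite pbracketC pbracket_lin opprD -scalerN -(pbracketC f) -(pbracketC f').
Qed.

Lemma pbracketxx f : pbracket f f = 0.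
Proof. by apply: polyfamP => n; rewrite !pbracketE /path_bracket; ring. Qed.

Lemma pder_lin (a : rat) f f' g :
  pder (a *: f + f') g = a *: pder f g + pder f' g.
Proof.
apply: polyfamP => n; rewrite polyfamDE polyfamZE !pderE.
rewrite (eq_der _ (at_vars_lin a f f') (frefl _)) der_lin.
by rewrite mul_mpolyC.
Qed.

Lemma pder_linr (a : rat) f g g' :
  pder f (a *: g + g') = a *: pder f g + pder f g'.
Proof.
apply: polyfamP => n; rewrite polyfamDE polyfamZE !pderE.
rewrite (eq_der _ (frefl _) (at_vars_lin a g g')) der_linr.
by rewrite mul_mpolyC.
Qed.

Definition no_const (f : polyfam) : Prop := f 0%N = 0.

Lemma at_vars1 N f (a : 'I_N.+1) : no_const f -> at_vars f [:: a] = 0.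
Proof. by move=> f0; rewrite /at_vars /= f0 subst_rename raddf0. Qed.

Lemma no_const_bracket f g : no_const f -> no_const g -> no_const (pbracket f g).
Proof.
move=> f0 g0; rewrite /no_const !pbracketE.
have -> : enum 'I_1 = [:: ord0] by rewrite enum_mkseq /=; congr [:: _]; apply: val_inj; rewrite /= inordK.
by rewrite path_bracket_singleton ?at_vars1.
Qed.

Lemma pder_bracket f g h : no_const f -> no_const g ->
  pder (pbracket f g) h = pder f (pder g h) - pder g (pder f h).
Proof.
move=> f0 g0; apply: polyfamP => n.
rewrite !(polyfamDE, polyfamNE) pderE (eq_der _ (at_vars_bracket f g) (frefl _)).
rewrite -der_bracket; [|by move=> a; exact: at_vars1 ..].
congr (_ - _); rewrite !pderE; apply: eq_der => // r; by rewrite at_vars_der.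
Qed.

(** The letter z itself. It lies outside the direct sum, having a component in Q[z_0], and is only
    acted on. *)
Definition z_fam : polyfam :=
  fun n => match n return {mpoly rat[n.+1]} with 0 => 'X_ord0 | _ => 0 end.

Lemma at_vars_z N (s : seq 'I_N.+1) :
  at_vars z_fam s = if s is [:: a] then 'X_a else 0.
Proof.
case: s => [|a [|b s]] //=; rewrite subst_rename ?raddf0 //.
by rewrite renameX.
Qed.

(** On a function supported on single letters only the block filling the whole word counts; it
    leaves its first or its last letter. *)
Lemma der_letter (T : Type) (R : comNzRingType) (F : seq T -> R) (z : T -> R) a s :
  der F (fun s => if s is [:: a] then z a else 0) (a :: s) =
  F (a :: s) * (z a - z (last a s)).
Proof.
rewrite /= -[RHS](dec_nil2 s (fun v => F (a :: v) * (z a - z (last a v)))).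
rewrite -[RHS]addr0; congr (_ + _).
  by apply: eq_dec => v [|b t] _ //; rewrite subrr mulr0.
case: s => [|b s] //=; rewrite der0 addr0 -[RHS](dec0 _ s).
by apply: eq_dec => v t _; rewrite subrr mulr0.
Qed.

Lemma pder_z f n : pder f z_fam n = f n * ('X_ord0 - 'X_ord_max).
Proof.
rewrite !pderE (eq_der _ (frefl _) (@at_vars_z n)) -[in RHS](at_vars_enum n f).
have lastE a s : enum 'I_n.+1 = a :: s -> last a s = ord_max.
  move=> E; rewrite (last_nth ord0).
  have := size_enum_ord n.+1; rewrite E /= => -[->]; rewrite -E.
  by apply: val_inj; rewrite /= nth_enum_ord.
have headE a s : enum 'I_n.+1 = a :: s -> a = ord0.
  move=> E; rewrite -[a]/(nth ord0 (a :: s) 0) -E.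
  by apply: val_inj; rewrite /= nth_enum_ord.
case: (enum 'I_n.+1) (size_enum_ord n.+1) lastE headE => // a s _ lastE headE.
by rewrite der_letter (lastE a s) // (headE a s).
Qed.

(** Polynomials form a domain, and z_0 - z_n is nonzero as soon as n >= 1; n = 0 is the case covered
    by [no_const]. *)
Lemma pder_faithful f : no_const f -> pder f z_fam = 0 -> f = 0.
Proof.
move=> f0 df; apply: polyfamP => -[|n]; first exact: f0.
have /eqP := pder_z f n.+1; rewrite df eq_sym mulf_eq0 => /orP[/eqP//|].
rewrite subr_eq0 => /eqP/(congr1 (fun p : {mpoly rat[n.+2]} => p@_U_(ord0))).
by rewrite !mcoeffX eqxx eq_mnm1 -(inj_eq val_inj) /= => /eqP; rewrite oner_eq0.
Qed.

Lemma pbracket_lie : lie_algebra pbracket no_const.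
Proof.
split.
- split=> [//|a u v u0 v0]; rewrite /no_const.
  by rewrite -[LHS]/(a *: u 0%N + v 0%N) u0 v0 scaler0 addr0.
- exact: no_const_bracket.
- by move=> a u v w _ _ _; rewrite pbracket_lin pbracket_linr.
- by move=> u _; exact: pbracketxx.
- move=> u v w u0 v0 w0; apply: pder_faithful.
    rewrite /no_const !polyfamDE.
    by rewrite !no_const_bracket ?addr0 //; exact: no_const_bracket.
  have pderD f f' g : pder (f + f') g = pder f g + pder f' g.
    by rewrite -[f]scale1r pder_lin !scale1r.
  have pderB f g g' : pder f (g - g') = pder f g - pder f g'.
    by rewrite addrC -scaleN1r pder_linr scaleN1r addrC.
  rewrite 2!pderD !pder_bracket ?pderB; try by [|exact: no_const_bracket].
  by apply: polyfamP => n; rewrite !(polyfamDE, polyfamNE); ring.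
Qed.
Arguments at_vars : simpl never.

(** * Comparison with the two brackets *)

Definition cyclic_fam (f : polyfam) : Prop :=
  forall N, cyclic (at_vars f : seq 'I_N.+1 -> _).

Definition skew_rev_fam (f : polyfam) : Prop :=
  forall N, skew_rev (at_vars f : seq 'I_N.+1 -> _).

Lemma cyclic_fam_bracket f g :
  cyclic_fam f -> cyclic_fam g -> cyclic_fam (pbracket f g).
Proof.
move=> fcyc gcyc N s t; rewrite !at_vars_bracket.
exact: cyclic_path_bracket.
Qed.

Lemma skew_rev_fam_bracket f g :
  skew_rev_fam f -> skew_rev_fam g -> skew_rev_fam (pbracket f g).
Proof.
move=> frev grev N s; rewrite !at_vars_bracket.
exact: path_bracket_rev.
Qed.

Lemma filter_notin_mid (T : eqType) (x y z : seq T) :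
  uniq (x ++ y ++ z) -> [seq k <- x ++ y ++ z | k \notin y] = x ++ z.
Proof.
rewrite cat_uniq cat_uniq => /and3P[_ xyz /and3P[_ yz _]].
rewrite !filter_cat (_ : filter _ y = [::]); last first.
  by apply/eqP; rewrite -(negbK (_ == _)) -has_filter; apply/hasPn => k ky /=; rewrite ky.
congr (_ ++ _); apply/all_filterP/allP => k kx.
  apply: contra xyz => ky; apply/hasP; exists k => //=.
  by rewrite mem_cat ky.
by apply: contra yz => ky; apply/hasP; exists k.
Qed.

Lemma nth_rot_enum N i j : (i < N.+1)%N -> (j < N.+1)%N ->
  nth ord0 (rot i (enum 'I_N.+1)) j = cyc N (i + j).
Proof.
move=> lt_i lt_j; apply: val_inj.
rewrite /cyc /= inordK ?ltn_pmod // /rot nth_cat size_drop size_enum_ord.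
case: ifP => lt_ij; first by rewrite nth_drop nth_enum_ord ?modn_small; lia.
rewrite nth_take ?nth_enum_ord; try lia.
have -> : (i + j = j - (N.+1 - i) + N.+1)%N by lia.
by rewrite modnDr modn_small; lia.
Qed.

(** [omit] lists the remaining variables in increasing order, the bracket on words lists them
    cyclically from position [i]; the two lists differ by a rotation. *)
Lemma subst_omit N f (A : seq 'I_N.+1) i (L : seq 'I_N.+1) m :
  cyclic_fam f -> [seq k <- rot i (enum 'I_N.+1) | k \notin A] = L ->
  size L = m.+1 -> subst (f m) (omit A) = at_vars f L.
Proof.
move=> fcyc <- sz.
have /= <- : at_vars f [seq k <- enum 'I_N.+1 | k \notin A] =
       at_vars f [seq k <- rot i (enum 'I_N.+1) | k \notin A].
  by rewrite -{1}(cat_take_drop i (enum 'I_N.+1)) /rot !filter_cat fcyc.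
rewrite (@at_varsE _ _ _ m ord0) // -sz -{1}(cat_take_drop i (enum 'I_N.+1)) /rot.
by rewrite !filter_cat !size_cat addnC.
Qed.

Lemma ihara_pbracket f g : no_const f -> no_const g ->
  cyclic_fam f -> cyclic_fam g -> ihara f g = pbracket f g.
Proof.
move=> f0 g0 fcyc gcyc; apply: polyfamP => N.
rewrite pbracketE path_bracket_cyclic // size_enum_ord /ihara exchange_big /=.
apply: eq_bigr => i _.
set L := rot i (enum 'I_N.+1).
have szL : size L = N.+1 by rewrite size_rot size_enum_ord.
have uL : uniq L by rewrite rot_uniq enum_uniq.
have slice k m : (k + m <= N.+1)%N ->
    [seq cyc N (i + j) | j <- iota k m] = take m (drop k L).
  move=> le_km; apply: (@eq_from_nth _ ord0).
    by rewrite size_map size_iota size_take size_drop szL; case: ltnP; lia.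
  move=> j; rewrite size_map size_iota => lt_jm.
  rewrite (nth_map 0%N) ?size_iota // nth_iota // nth_take // nth_drop.
  by rewrite nth_rot_enum //; lia.
case EL: L => [|a r] /=; first by rewrite EL in szL.
have szr : size r = N by move: szL; rewrite EL => -[].
rewrite dec_sum szr -(big_mkord predT (fun m => at_vars f (a :: take m r) *
  (at_vars g (a :: drop m r) - at_vars g (last a (take m r) :: drop m r)))).
rewrite [RHS]big_ltn //= take0 (at_vars1 a f0) mul0r add0r.
(* For [m = N] both arguments of [g] are single variables. The summand [m = 0], where [f] has a
   single variable, is already gone; this leaves the range of [ihara]. *)
have -> : \sum_(1 <= m < N.+1) at_vars f (a :: take m r) *
    (at_vars g (a :: drop m r) - at_vars g (last a (take m r) :: drop m r)) =
  \sum_(1 <= m < N) at_vars f (a :: take m r) *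
    (at_vars g (a :: drop m r) - at_vars g (last a (take m r) :: drop m r)).
  have [N0|N0] := posnP N; first by rewrite !big_geq ?N0.
  rewrite big_nat_recr //= drop_oversize ?szr // !at_vars1 // subrr mulr0.
  by rewrite addr0.
apply: eq_big_nat => m /andP[m0 mN].
have lt_i := ltn_ord i.
have sz_drop : size (drop m r) = (N - m)%N by rewrite size_drop szr.
congr (_ * (_ - _)).
- rewrite -[a :: take m r]/(take m.+1 (a :: r)) -EL.
  rewrite (@at_varsE _ _ _ m ord0) ?size_take ?szL; last by case: ltnP; lia.
  apply: eq_subst => j lt_j; rewrite nth_take // nth_rot_enum //; lia.
- apply: (@subst_omit _ _ _ i) => //; last by rewrite /= sz_drop.
  rewrite slice; last by lia.
  have -> : drop 1 L = r by rewrite EL /= drop0.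
  have := @filter_notin_mid _ [:: a] (take m r) (drop m r).
  by rewrite cat_take_drop -[[:: a] ++ r]/(a :: r) -EL => /(_ uL).
- apply: (@subst_omit _ _ _ i) => //; last by rewrite /= sz_drop.
  rewrite slice ?drop0; last by lia.
  rewrite -/L.
  have -> : last a (take m r) :: drop m r = drop m L.
    rewrite EL -{3}[r](cat_take_drop m) -cat_cons [a :: take m r]lastI cat_rcons drop_size_cat //.
    by rewrite size_belast size_take szr; case: ltnP; lia.
  have := @filter_notin_mid _ [::] (take m L) (drop m L).
  by rewrite /= cat_take_drop => ->.
Qed.

Definition even_degree (f : polyfam) : Prop :=
  forall n m, m \in msupp (f n) -> ~~ odd (mdeg m).

Lemma sign_twist_even r (p : {mpoly rat[r.+1]}) :
  (forall m, m \in msupp p -> ~~ odd (mdeg m)) -> sign_twist p = (-1) ^+ r *: p.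
Proof.
move=> p_even; rewrite /sign_twist [in RHS](pihomog_partitionE (leqnn (msize p))).
rewrite scaler_sumr; apply: eq_bigr => d _.
have [d_odd|d_even] := boolP (odd d); last first.
  by rewrite exprD -signr_odd (negbTE d_even) mul1r.
suff -> : pihomog mdeg d p = 0 by rewrite !scaler0.
rewrite pihomogE big_seq_cond big1 // => m /andP[/p_even m_even /eqP md].
by rewrite md d_odd in m_even.
Qed.

Lemma exchange_triangle (V : nmodType) N (X : nat -> nat -> V) :
  \sum_(0 <= i < N.+1) \sum_(0 <= m < (N - i).+1) X i m =
  \sum_(0 <= m < N.+1) \sum_(0 <= i < (N - m).+1) X i m.
Proof.
have E (Y : nat -> nat -> V) : \sum_(0 <= i < N.+1) \sum_(0 <= m < (N - i).+1) Y i m =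
    \sum_(0 <= i < N.+1) \sum_(0 <= m < N.+1 | (i + m <= N)%N) Y i m.
  apply: eq_big_nat => i /andP[_ lt_i].
  rewrite (big_nat_widen _ _ N.+1); last by lia.
  by apply: eq_bigl => m /=; rewrite ltnS leq_subRL // -ltnS.
rewrite !E (exchange_big_dep_nat predT) //=.
apply: eq_big_nat => m _.
by apply: eq_bigl => i; rewrite addnC.
Qed.

Lemma substZ m N a (p : {mpoly rat[m.+1]}) (h : nat -> 'I_N.+1) :
  subst (a *: p) h = a *: subst p h.
Proof. by rewrite !subst_rename linearZ. Qed.

Lemma cut_mkseq (T : Type) (h : nat -> T) k m n : (k + m <= n)%N ->
  take k (mkseq h n) ++ drop (k + m) (mkseq h n) =
  mkseq (fun j => h (if (j < k)%N then j else j + m)%N) (n - m).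
Proof.
move=> le_km; apply: (@eq_from_nth _ (h 0%N)).
  rewrite size_cat size_takel ?size_drop ?size_mkseq; lia.
move=> j; rewrite size_cat size_takel ?size_drop ?size_mkseq; last by lia.
move=> lt_j; rewrite nth_cat size_takel ?size_mkseq; last by lia.
rewrite [RHS]nth_mkseq; last by lia.
case: ltnP => lt_jk; first by rewrite nth_take // nth_mkseq //; lia.
by rewrite nth_drop nth_mkseq; [congr h; lia | lia].
Qed.

Lemma slice_mkseq (T : Type) (h : nat -> T) i m n : (i + m <= n)%N ->
  take m (drop i (mkseq h n)) = mkseq (fun j => h (i + j)%N) m.
Proof.
move=> le_im; apply: (@eq_from_nth _ (h 0%N)).
  by rewrite size_takel ?size_drop ?size_mkseq //; lia.
move=> j; rewrite size_takel ?size_drop ?size_mkseq; last by lia.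
by move=> lt_j; rewrite nth_take // nth_drop !nth_mkseq //; lia.
Qed.

Lemma drop_mkseq_cons (T : Type) (h : nat -> T) i n : (i < n)%N ->
  drop i (mkseq h n) = h i :: drop i.+1 (mkseq h n).
Proof.
by move=> lt_i; rewrite (drop_nth (h 0%N)) ?size_mkseq // nth_mkseq.
Qed.

(** The first sum of [dg_circ] is the positive half of [der]. In the second, reversing [f] costs
    (-1)^(r+1) against the twist (-1)^r, which gives the negative half, except for the blocks with i
    = 0: those are cancelled by [path_mul]. *)
Lemma dg_circE f g N : no_const f -> no_const g -> even_degree f ->
  skew_rev_fam f ->
  dg_circ f g N = der (at_vars f) (at_vars g) (enum 'I_N.+1)
                  + path_mul (at_vars f) (at_vars g) (enum 'I_N.+1).
Proof.
move=> f0 g0 fev frev.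
pose F i m : {mpoly rat[N.+1]} := at_vars f (mkseq (fun j => inord (i + j)) m.+1).
(* The variables left out of [g] are z_i, ..., z_(i+m-1), so that [A i.+1 m] and [A i m] keep the
   first and the last variable of the block in [F i m]. *)
pose A i m : {mpoly rat[N.+1]} := at_vars g (mkseq (fun j => inord (if (j < i)%N then j else j + m)%N) (N - m).+1).
have prefix i m : (i + m <= N)%N ->
  inord i :: take m (drop i.+1 (mkseq inord N.+1)) = mkseq (fun j => inord (i + j) : 'I_N.+1) m.+1.
  move=> le_im; rewrite -(@slice_mkseq _ inord i m.+1 N.+1); last by lia.
  by rewrite (@drop_mkseq_cons _ inord i) //; lia.
have cut1 i m : (i + m <= N)%N ->
  at_vars g (take i (mkseq inord N.+1) ++ inord i :: drop m (drop i.+1 (mkseq inord N.+1))) = A i.+1 m.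
  move=> le_im; rewrite /A -subSn; last by lia.
  rewrite -cut_mkseq; last by lia.
  rewrite drop_drop (take_nth ord0) ?size_mkseq; last by lia.
  by rewrite nth_mkseq ?cat_rcons ?[(m + _)%N]addnC //; lia.
have cut2 i m : (i + m <= N)%N ->
  at_vars g (take i (mkseq inord N.+1) ++ last (inord i) (take m (drop i.+1 (mkseq inord N.+1)))
     :: drop m (drop i.+1 (mkseq inord N.+1))) = A i m.
  move=> le_im; rewrite /A -subSn; last by lia.
  rewrite -cut_mkseq; last by lia.
  congr (at_vars g (_ ++ _)).
  rewrite -[last _ _](last_cons (inord i)) prefix //.
  rewrite (last_nth (inord i)) size_mkseq -[nth _ _ _]/(nth (inord i) (mkseq (fun j => inord (i + j) : 'I_N.+1) m.+1) m).
  rewrite nth_mkseq // drop_drop (@drop_mkseq_cons _ inord (i + m)); last by lia.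
  by rewrite addnS [(m + i)%N]addnC.
have derE : der (at_vars f) (at_vars g) (enum 'I_N.+1) =
    \sum_(0 <= i < N.+1) \sum_(0 <= m < (N - i).+1) F i m * (A i.+1 m - A i m).
  rewrite enum_mkseq der_expand' dec_sum size_mkseq big_ord_recr.
  rewrite drop_oversize ?size_mkseq //= addr0 big_mkord.
  apply: eq_bigr => i _; have lt_i := ltn_ord i.
  rewrite drop_mkseq_cons // dec_sum size_drop size_mkseq subSS big_mkord.
  apply: eq_bigr => m _; have lt_m := ltn_ord m.
  by rewrite prefix ?cut1 ?cut2 //; lia.
have mulE : path_mul (at_vars f) (at_vars g) (enum 'I_N.+1) =
    \sum_(0 <= m < N.+1) F 0 m * A 0 m.
  rewrite enum_mkseq -[mkseq _ _]drop0 drop_mkseq_cons //.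
  rewrite /path_mul dec_sum size_drop size_mkseq subSS subn0 big_mkord.
  apply: eq_bigr => m _; have lt_m := ltn_ord m.
  rewrite prefix; last by lia.
  by have := cut2 0%N m; rewrite take0 /= => -> //; lia.
have F0 i : F i 0%N = 0 by apply: at_vars1.
have AN i m : m = N -> A i m = 0 by rewrite /A => ->; rewrite subnn; apply: at_vars1.
have -> : der (at_vars f) (at_vars g) (enum 'I_N.+1)
        + path_mul (at_vars f) (at_vars g) (enum 'I_N.+1) =
    \sum_(0 <= i < N.+1) \sum_(0 <= m < (N - i).+1) (F i m * A i.+1 m - (if (0 < i)%N then F i m * A i m else 0)).
  rewrite derE mulE big_ltn // [RHS]big_ltn // addrAC; congr (_ + _).
    rewrite subn0 -big_split; apply: eq_bigr => m _ /=.
    by rewrite mulrBr subr0 subrK.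
  rewrite !big_add1 /=; apply: eq_bigr => i _; apply: eq_bigr => m _.
  by rewrite mulrBr.
rewrite (exchange_triangle N (fun i m => F i m * A i.+1 m - (if (0 < i)%N then F i m * A i m else 0))).
rewrite big_ltn // [X in _ = X + _]big1 ?add0r; last first.
  by move=> i _; rewrite F0 !mul0r if_same subr0.
rewrite /dg_circ.
have -> : \sum_(1 <= m < N.+1) \sum_(0 <= i < (N - m).+1)
    (F i m * A i.+1 m - (if (0 < i)%N then F i m * A i m else 0)) =
  \sum_(1 <= m < N) \sum_(0 <= i < (N - m).+1)
    (F i m * A i.+1 m - (if (0 < i)%N then F i m * A i m else 0)).
  have [N0|N0] := posnP N; first by rewrite !big_geq ?N0.
  rewrite big_nat_recr //= [X in _ + X]big1 ?addr0 // => i _.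
  by rewrite !AN // !mulr0 if_same subr0.
apply: eq_big_nat => m /andP[m0 mN].
rewrite sumrB; congr (_ + _).
  by apply: eq_bigr => i _; rewrite /F /A !at_vars_mkseq.
rewrite [in RHS]big_ltn //= add0r -sumrN; apply: eq_big_nat => i /andP[i0 iN].
rewrite i0 -mulNr /F /A !at_vars_mkseq; congr (_ * _).
rewrite sign_twist_even; last by exact: fev.
rewrite substZ.
rewrite -!at_vars_mkseq.
have -> : mkseq (fun j => inord (i + m - j) : 'I_N.+1) m.+1 =
     rev (mkseq (fun j => inord (i + j)) m.+1).
  apply: (@eq_from_nth _ ord0); rewrite ?size_rev !size_mkseq // => j lt_j.
  rewrite nth_rev ?size_mkseq // !nth_mkseq //; last by lia.
  by congr inord; lia.
rewrite frev size_mkseq exprS mulN1r mulNr scalerN; congr (- _).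
rewrite -signr_odd scaler_sign -signr_odd mulr_sign.
by case: odd; rewrite ?opprK.
Qed.

Lemma dg_ihara_pbracket f g :
  no_const f -> no_const g -> even_degree f -> even_degree g ->
  skew_rev_fam f -> skew_rev_fam g -> dg_ihara f g = pbracket f g.
Proof.
move=> f0 g0 fev gev frev grev; apply: polyfamP => N.
rewrite /dg_ihara polyfamDE polyfamNE !dg_circE // pbracketE /path_bracket.
by ring.
Qed.

(** * Even parts *)

Definition even_mnm n (m : 'X_{1..n}) : bool := [forall i, ~~ odd (m i)].

Lemma mcoeff_even_part n (p : {mpoly rat[n.+1]}) m :
  (even_part p)@_m = if even_mnm m then p@_m else 0.
Proof.
rewrite /even_part raddf_sum /= big_mkcond /=.
have [m_p|m_p] := boolP (m \in msupp p); last first.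
  rewrite (memN_msupp_eq0 m_p) if_same big_seq big1 // => k k_p.
  case: ifP => // _; rewrite mcoeffZ mcoeffX.
  by case: eqP m_p k_p => [->|]; [move=> /negbTE -> | rewrite mulr0].
rewrite (bigD1_seq m) //= ?msupp_uniq // big1 ?addr0.
  by rewrite /even_mnm; case: ifP => // _; rewrite mcoeffZ mcoeffX eqxx mulr1.
move=> k ne_km; case: ifP => // _.
by rewrite mcoeffZ mcoeffX (negbTE ne_km) mulr0.
Qed.

Lemma even_part_is_linear n : linear (@even_part n).
Proof.
move=> a p q; apply/mpolyP => m; rewrite mcoeffD mcoeffZ !mcoeff_even_part.
by rewrite mcoeffD mcoeffZ; case: ifP; rewrite ?mulr0 ?addr0.
Qed.

HB.instance Definition _ n :=
  GRing.isLinear.Build rat {mpoly rat[n.+1]} {mpoly rat[n.+1]} _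
    (@even_part n) (@even_part_is_linear n).

Lemma even_partX n (m : 'X_{1..n.+1}) :
  even_part 'X_[m] = if even_mnm m then 'X_[m] else 0.
Proof.
apply/mpolyP => k; rewrite mcoeff_even_part [in RHS]fun_if mcoeffX mcoeff0.
by case: eqP => [->|_]; rewrite ?if_same.
Qed.

Lemma eq_mpoly_linear n (V : lmodType rat) (f g : {linear {mpoly rat[n]} -> V}) :
  (forall m, f 'X_[m] = g 'X_[m]) -> f =1 g.
Proof.
move=> fg p; rewrite [p]mpolyE !linear_sum; apply: eq_bigr => m _.
by rewrite !linearZ /= fg.
Qed.

(** [c] is the only variable that both factors may involve. If all exponents of a product of
    monomials are even, so are those of each factor away from [c], and even degree then settles the
    exponent of [c]. *)
Lemma even_partM n (p q : {mpoly rat[n.+1]}) c :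
    (forall m, m \in msupp p -> ~~ odd (mdeg m)) ->
    (forall m, m \in msupp q -> ~~ odd (mdeg m)) ->
    (forall m k i, m \in msupp p -> k \in msupp q -> i != c ->
       m i = 0%N \/ k i = 0%N) ->
  even_part (p * q) = even_part p * even_part q.
Proof.
move=> p_even q_even pq_disj.
rewrite {1}[p]mpolyE {1}[q]mpolyE [in RHS](mpolyE p) [in RHS](mpolyE q).
rewrite !raddf_sum !mulr_suml raddf_sum /=.
rewrite big_seq [RHS]big_seq; apply: eq_bigr => m m_p.
rewrite !mulr_sumr raddf_sum /=.
rewrite big_seq [RHS]big_seq; apply: eq_bigr => k k_q.
rewrite -scalerAl -scalerAr -mpolyXD !linearZ /= -scalerAl -scalerAr.
congr (_ *: (_ *: _)); rewrite !even_partX.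
have {}pq_disj i := pq_disj m k i m_p k_q.
have even_at (r : 'X_{1..n.+1}) : ~~ odd (mdeg r) ->
    (forall i, i != c -> ~~ odd (r i)) -> ~~ odd (r c).
  move=> r_even rc; move: r_even; rewrite mdegE (bigD1 c) //= oddD.
  suff -> : odd (\sum_(i | i != c) r i) = false by rewrite addbF.
  apply/negbTE; elim/big_rec: _ => // i x /rc ri x_even.
  by rewrite oddD (negbTE ri).
have -> : even_mnm (m + k)%MM = even_mnm m && even_mnm k.
  apply/forallP/andP => [mk|[/forallP m_even /forallP k_even] i]; last first.
    by rewrite mnmDE oddD (negbTE (m_even i)) (negbTE (k_even i)).
  have m_off i : i != c -> ~~ odd (m i).
    by move=> /pq_disj [->|k0] //; move: (mk i); rewrite mnmDE k0 addn0.
  have k_off i : i != c -> ~~ odd (k i).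
    by move=> /pq_disj [m0|->] //; move: (mk i); rewrite mnmDE m0.
  by split; apply/forallP => i; have [->|] := eqVneq i c;
    [apply: even_at; auto | auto | apply: even_at; auto | auto].
case: (even_mnm m) (even_mnm k) => [] []; rewrite ?mulr0 ?mul0r //.
by rewrite mpolyXD.
Qed.

Definition push_mnm n N (h : 'I_n -> 'I_N) (m : 'X_{1..n}) : 'X_{1..N} :=
  (\sum_i U_(h i) *+ m i)%MM.

Lemma renameXm n N (h : 'I_n.+1 -> 'I_N.+1) m :
  rename h 'X_[m] = 'X_[push_mnm h m].
Proof.
rewrite mpolyXE_id rmorph_prod /= -mprodXnE.
by apply: eq_bigr => i _; rewrite rmorphXn /= renameX.
Qed.

Lemma push_mnmE n N (h : 'I_n -> 'I_N) m j :
  push_mnm h m j = (\sum_(i | h i == j) m i)%N.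
Proof.
rewrite /push_mnm mnm_sumE [RHS]big_mkcond; apply: eq_bigr => i _.
by rewrite mulmnE mnm1E; case: eqP; rewrite ?mul1n ?mul0n.
Qed.

Lemma mdeg_push n N (h : 'I_n -> 'I_N) m : mdeg (push_mnm h m) = mdeg m.
Proof.
rewrite /push_mnm mdeg_sum mdegE; apply: eq_bigr => i _.
by rewrite mdegMn mdeg1 mul1n.
Qed.

Lemma renameE n N (h : 'I_n.+1 -> 'I_N.+1) p :
  rename h p = \sum_(m <- msupp p) p@_m *: 'X_[push_mnm h m].
Proof.
rewrite {1}[p]mpolyE (raddf_sum (rename h)); apply: eq_bigr => m _.
by rewrite /= renameZ renameXm.
Qed.

Lemma msupp_rename n N (h : 'I_n.+1 -> 'I_N.+1) p k :
  k \in msupp (rename h p) -> exists2 m, m \in msupp p & k = push_mnm h m.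
Proof.
rewrite mcoeff_msupp renameE raddf_sum /= big_seq.
have [/hasP[m m_p /eqP ->]|/hasPn no_m] := boolP (has (fun m => k == push_mnm h m) (msupp p)).
  by exists m.
rewrite big1 ?eqxx // => m m_p.
by rewrite mcoeffZ mcoeffX eq_sym (negbTE (no_m _ m_p)) mulr0.
Qed.

Lemma even_part_rename n N (h : 'I_n.+1 -> 'I_N.+1) p : injective h ->
  even_part (rename h p) = rename h (even_part p).
Proof.
move=> h_inj.
have := @eq_mpoly_linear _ _ (@even_part N \o rename h) (rename h \o @even_part n).
apply=> m /=; rewrite renameXm !even_partX.
have -> : even_mnm (push_mnm h m) = even_mnm m.
  apply/forallP/forallP => [m_even i|m_even j].
    have := m_even (h i); rewrite push_mnmE (eq_bigl (pred1 i)) ?big_pred1_eq //.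
    by move=> k /=; rewrite (inj_eq h_inj).
  rewrite push_mnmE; elim/big_rec: _ => // i x _ x_even.
  by rewrite oddD (negbTE (m_even i)).
by case: ifP => _; rewrite ?renameXm ?raddf0.
Qed.

Lemma at_vars_rename N f (a : 'I_N.+1) s :
  at_vars f (a :: s) = rename (fun i : 'I_(size s).+1 => nth a (a :: s) i) (f (size s)).
Proof. by []. Qed.

(** Distinctness matters: identifying two variables can turn odd exponents into an even one. *)
Lemma at_vars_pi_e N f (s : seq 'I_N.+1) :
  uniq s -> at_vars (pi_e f) s = even_part (at_vars f s).
Proof.
case: s => [|a s] uniq_s; first by rewrite /at_vars raddf0.
rewrite !at_vars_rename even_part_rename // => i j /eqP.
by rewrite nth_uniq ?ltn_ord // => /eqP/val_inj.
Qed.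

Lemma msupp_at_vars N f (s : seq 'I_N.+1) k :
  k \in msupp (at_vars f s) ->
  (exists2 m, m \in msupp (f (size s).-1) & mdeg k = mdeg m) /\
  (forall i, i \notin s -> k i = 0%N).
Proof.
case: s => [|a s]; first by rewrite /at_vars msupp0.
rewrite at_vars_rename => /msupp_rename [m m_f ->]; split.
  by exists m => //; rewrite mdeg_push.
move=> i i_s; rewrite push_mnmE big_pred0 // => j.
apply/negbTE; apply: contra i_s => /eqP <-; exact: mem_nth.
Qed.

Lemma pi_e_bracket f g : even_degree f -> even_degree g ->
  pi_e (pbracket f g) = pbracket (pi_e f) (pi_e g).
Proof.
move=> f_even g_even; apply: polyfamP => N; rewrite /pi_e !pbracketE.
have : uniq (enum 'I_N.+1) by exact: enum_uniq.
move: (enum _) => s uniq_s.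
apply: (path_bracket_additive (f := @even_part N)) => u a v t c Es c_av.
have [uav uuct disj] : [/\ uniq (a :: v), uniq (u ++ c :: t) &
    forall i, i != c -> i \notin a :: v \/ i \notin u ++ c :: t].
  have c_v : c \in a :: v by case: c_av => ->; rewrite ?mem_head ?mem_last.
  move: uniq_s; rewrite -Es -cat_cons uniq_catCA cat_uniq => /and3P[uav av uut].
  have ni i : i \in a :: v -> i \notin u ++ t.
    by move=> i_v; apply: contra av => i_ut; apply/hasP; exists i.
  split=> // [|i ne_ic].
    by rewrite -cat1s uniq_catCA /= uut andbT ni.
  have [/ni|] := boolP (i \in a :: v); last by left.
  by move=> i_ut; right; move: i_ut; rewrite !mem_cat inE (negbTE ne_ic).
rewrite !at_vars_pi_e //; split; apply: (even_partM (c := c)).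
all: try by move=> m /msupp_at_vars [[m' m'_f ->] _]; (exact: f_even m'_f || exact: g_even m'_f).
  move=> m k i /msupp_at_vars [_ m_i] /msupp_at_vars [_ k_i] /disj [].
    by move=> /m_i; left.
  by move=> /k_i; right.
move=> m k i /msupp_at_vars [_ m_i] /msupp_at_vars [_ k_i] /disj [].
  by move=> /m_i; left.
by move=> /k_i; right.
Qed.

(** The number of variables minus one is additive on the products in the bracket, so the powers of 2
    of the factors multiply to [2 ^+ N]. *)
Lemma pi_sdg_bracket f g : even_degree f -> even_degree g ->
  pi_sdg (pbracket f g) = pbracket (pi_sdg f) (pi_sdg g).
Proof.
have at_sdg N h (s : seq 'I_N.+1) :
    at_vars (pi_sdg h) s = 2 ^+ (size s).-1 *: at_vars (pi_e h) s.
  by case: s => [|a s]; rewrite ?scaler0 //= !at_vars_rename -renameZ.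
move=> f_even g_even; apply: polyfamP => N.
rewrite -[LHS]/(2 ^+ N *: pi_e (pbracket f g) N) pi_e_bracket // !pbracketE.
have -> : 2 ^+ N = 2 ^+ (size (enum 'I_N.+1)).-1 :> rat by rewrite size_enum_ord.
apply: (path_bracket_additive (f := GRing.scale _)) => u a v t c Es _.
rewrite !at_sdg -!scalerAl -!scalerAr !scalerA -exprD.
by rewrite -Es !size_cat /= !(addnS, addSn, size_cat) /= addnCA.
Qed.

(** Parity of exponents is expressed as invariance under a ring morphism, which passes through
    brackets and powers. *)
Definition sgn_hom n (e : 'I_n -> nat) : {mpoly rat[n]} -> {mpoly rat[n]} :=
  comp_mpoly [tuple (-1) ^+ e i *: 'X_i | i < n].

HB.instance Definition _ n e := GRing.LRMorphism.on (@sgn_hom n e).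

Lemma sgn_homX n (e : 'I_n -> nat) i : sgn_hom e 'X_i = (-1) ^+ e i *: 'X_i.
Proof. by rewrite /sgn_hom comp_mpolyXU -tnth_nth tnth_mktuple. Qed.

Lemma mcoeff_sgn_hom n (e : 'I_n -> nat) p m :
  (sgn_hom e p)@_m = (-1) ^+ (\sum_i e i * m i)%N * p@_m.
Proof.
have sgnXm k : sgn_hom e 'X_[k] = (-1) ^+ (\sum_i e i * k i)%N *: 'X_[k].
  rewrite mpolyXE_id rmorph_prod /= expr_sum -scaler_prod.
  by apply: eq_bigr => i _; rewrite rmorphXn /= sgn_homX exprZn exprM.
rewrite {1}[p]mpolyE (raddf_sum (sgn_hom e)) raddf_sum [in RHS](mpolyE p) raddf_sum mulr_sumr.
apply: eq_bigr => k _.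
rewrite /= [sgn_hom e _]comp_mpolyZ -/(sgn_hom e _) sgnXm !mcoeffZ mcoeffX.
by case: eqP => [->|_]; rewrite ?mulr0 // !mulr1 mulrC.
Qed.

Lemma even_mdegP n (p : {mpoly rat[n]}) :
  (forall m, m \in msupp p -> ~~ odd (mdeg m)) <-> sgn_hom (fun=> 1%N) p = p.
Proof.
have E (m : 'X_{1..n}) : (\sum_i 1 * m i)%N = mdeg m.
  by rewrite mdegE; apply: eq_bigr => i _; rewrite mul1n.
split=> [p_even|p_sgn m].
  apply/mpolyP => m; rewrite mcoeff_sgn_hom E.
  have [/p_even m_even|/memN_msupp_eq0 ->] := boolP (m \in msupp p).
    by rewrite -signr_odd (negbTE m_even) mul1r.
  by rewrite mulr0.
rewrite mcoeff_msupp; apply: contra => m_odd.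
move/(congr1 (mcoeff m)): p_sgn; rewrite mcoeff_sgn_hom E -signr_odd m_odd mulN1r.
by move/eqP; rewrite eq_sym -addr_eq0 -mulr2n Num.Theory.mulrn_eq0.
Qed.

Lemma sgn_hom_rename n N (h : 'I_n.+1 -> 'I_N.+1) p :
  sgn_hom (fun=> 1%N) (rename h p) = rename h (sgn_hom (fun=> 1%N) p).
Proof.
apply: (@eq_mpoly_linear _ _ (sgn_hom _ \o rename h) (rename h \o sgn_hom _)) => m /=.
rewrite mpolyXE_id !rmorph_prod; apply: eq_bigr => i _ /=.
by rewrite !rmorphXn /= renameX !sgn_homX renameZ renameX.
Qed.

Lemma even_degree_bracket f g :
  even_degree f -> even_degree g -> even_degree (pbracket f g).
Proof.
move=> f_even g_even n; apply/even_mdegP; rewrite pbracketE.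
have E h : even_degree h -> forall s : seq 'I_n.+1,
    sgn_hom (fun=> 1%N) (at_vars h s) = at_vars h (map id s).
  move=> h_even [|a s]; first by rewrite /at_vars raddf0.
  rewrite map_id at_vars_rename sgn_hom_rename (even_mdegP _).1 //.
  exact: h_even.
by rewrite (path_bracket_morph _ (E f f_even) (E g g_even)) map_id.
Qed.

(** A common form of the three kinds of generators, whose symmetries are then checked once. *)
Definition sym_gen (c d : rat) (k : nat) : polyfam :=
  in_depth1 (c *: (z0 + z1) ^+ k.*2 + d *: (z0 - z1) ^+ k.*2).

Lemma p_genE k :
  p_gen k = sym_gen ((2 ^+ k.*2)^-1 * (2 ^+ k.*2.+1 - 1)) (2 ^+ k.*2)^-1 k.
Proof. by rewrite /p_gen /sym_gen scalerDr scalerA. Qed.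

Lemma phi_genE k : phi_gen k = sym_gen 0 1 k.
Proof. by rewrite /phi_gen /sym_gen scale0r add0r scale1r. Qed.

Lemma e_genE k : e_gen k = sym_gen 1 1 k.
Proof. by rewrite /e_gen /sym_gen !scale1r. Qed.

Lemma at_vars_sym_gen N c d k (s : seq 'I_N.+1) :
  at_vars (sym_gen c d k) s =
  if s is [:: a; b] then
    c *: ('X_a + 'X_b) ^+ k.*2 + d *: ('X_a - 'X_b) ^+ k.*2
  else 0.
Proof.
case: s => [|a [|b [|x s]]] //; rewrite at_vars_rename ?raddf0 //=.
by rewrite raddfD /= !renameZ !rmorphXn raddfB raddfD /= !renameX.
Qed.

Lemma expr_doubleN (R : comNzRingType) (x : R) k : (- x) ^+ k.*2 = x ^+ k.*2.
Proof. by rewrite exprNn -signr_odd odd_double mul1r. Qed.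

Lemma no_const_sym_gen c d k : no_const (sym_gen c d k).
Proof. by []. Qed.

Lemma cyclic_sym_gen c d k : cyclic_fam (sym_gen c d k).
Proof.
move=> N s t; rewrite !at_vars_sym_gen.
case: s => [|a [|b [|x s]]]; case: t => [|a' [|b' [|x' t]]] //=.
  by rewrite -['X_a - _]opprB expr_doubleN ['X_a + _]addrC.
all: try by case: s.
all: try by case: t.
Qed.

Lemma skew_rev_sym_gen c d k : skew_rev_fam (sym_gen c d k).
Proof.
move=> N s; rewrite !at_vars_sym_gen.
have [sz|] := eqVneq (size s) 2.
  case: s sz => [|a [|b []]] //= _; rewrite expr2 mulN1r opprK mul1r.
  by rewrite /rev /= -['X_b - _]opprB expr_doubleN ['X_b + _]addrC.
move=> sz; have sz' : size (rev s) != 2 by rewrite size_rev.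
move: sz sz'; case: s (rev s) => [|a [|b [|x s]]] [|a' [|b' [|x' t]]] //= _ _;
  by rewrite ?mulr0.
Qed.

Lemma even_degree_sym_gen c d k : even_degree (sym_gen c d k).
Proof.
move=> [|[|n]] m; rewrite /= ?msupp0 //; move: m; apply/even_mdegP.
rewrite raddfD /= [sgn_hom _ (c *: _)]comp_mpolyZ [sgn_hom _ (d *: _)]comp_mpolyZ.
rewrite -!/(sgn_hom _ _) !rmorphXn raddfB raddfD /= !sgn_homX !expr1 !scaleN1r.
by rewrite -opprD expr_doubleN -opprD expr_doubleN.
Qed.

(** A sign change of z_1 exchanges the two powers and fixes even monomials, so both powers have the
    same even part; their sum is even in each variable, so that part is half the sum. The
    coefficients add up to 2 for p_(2k+1) but to 1 for phi_(2k+1), whence the extra 2 in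
    [pi_sdg]. *)
Lemma pi_e_sym_gen c d k :
  pi_e (sym_gen c d k) = sym_gen ((c + d) / 2) ((c + d) / 2) k.
Proof.
apply: polyfamP => -[|[|n]]; rewrite /pi_e /sym_gen /= ?raddf0 //.
set A := (_ + _) ^+ _; set B := (_ - _) ^+ _.
pose e (i : 'I_2) : nat := (i == ord_max).
have sum_e (m : 'X_{1..2}) : (\sum_i e i * m i)%N = m ord_max.
  by rewrite big_ord_recl big_ord1 /e /= mul0n add0n mul1n; congr (m _); apply: val_inj.
have sgnA : sgn_hom e A = B.
  by rewrite rmorphXn raddfD /= !sgn_homX expr0 expr1 scale1r scaleN1r.
have sgnB : sgn_hom e B = A.
  by rewrite rmorphXn raddfB /= !sgn_homX expr0 expr1 scale1r scaleN1r opprK.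
have evAB : even_part A = even_part B.
  apply/mpolyP => m; rewrite !mcoeff_even_part -sgnA mcoeff_sgn_hom sum_e.
  by case: ifP => // /forallP/(_ ord_max) m1; rewrite -signr_odd (negbTE m1) mul1r.
have sumAB : even_part (A + B) = A + B.
  apply/mpolyP => m; rewrite mcoeff_even_part; case: ifPn => // m_odd.
  apply/esym/eqP; apply: contraNT m_odd => AB_m.
  have m1 : ~~ odd (m ord_max).
    have : sgn_hom e (A + B) = A + B by rewrite raddfD /= sgnA sgnB addrC.
    move/(congr1 (mcoeff m)); rewrite mcoeff_sgn_hom sum_e -signr_odd.
    case: odd => // /eqP; rewrite mulN1r eq_sym -addr_eq0 -mulr2n.
    by rewrite Num.Theory.mulrn_eq0 (negbTE AB_m).
  have := @even_degree_sym_gen 1 1 k 1 m.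
  rewrite /sym_gen /= !scale1r -/A -/B mcoeff_msupp AB_m => /(_ isT).
  rewrite mdegE big_ord_recl big_ord1 oddD.
  rewrite (_ : lift ord0 ord0 = ord_max) ?(negbTE m1) ?addbF => [m0|]; last exact: val_inj.
  apply/forallP => -[[|[|//]] lt_i].
    by rewrite (_ : Ordinal lt_i = ord0) //; exact: val_inj.
  by rewrite (_ : Ordinal lt_i = ord_max) //; exact: val_inj.
have evA : even_part A = 2^-1 *: (A + B).
  rewrite -sumAB raddfD /= -evAB scalerDr -scalerDl.
  by rewrite (_ : 2^-1 + 2^-1 = 1) ?scale1r.
by rewrite raddfD /= !linearZ /= -evAB -scalerDl evA scalerA -scalerDr.
Qed.

(** * Free Lie algebras *)

Section LieSubalgebraType.
Variables (V : lmodType rat) (br : V -> V -> V) (S : V -> Prop).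

(* The proof argument lets the type carry its module structure. *)
Definition sub_pred (lieS : lie_algebra br S) : {pred V} := fun x => `[< S x >].

Variable lieS : lie_algebra br S.

Fact sub_pred_closed : submod_closed (sub_pred lieS).
Proof.
have [[S0 Slin] _ _ _ _] := lieS.
split; first exact/asboolP.
by move=> a u v /asboolP Su /asboolP Sv; apply/asboolP/Slin.
Qed.

HB.instance Definition _ := GRing.isSubmodClosed.Build rat V (sub_pred lieS) sub_pred_closed.

(** The universal property speaks only of Lie algebras filling their module, so [S] is made a module
    of its own. *)
Definition sub_lie : Type := {x : V | x \in sub_pred lieS}.

HB.instance Definition _ := [isSub of sub_lie for @sval _ _].
HB.instance Definition _ := [Choice of sub_lie by <:].
HB.instance Definition _ := [SubChoice_isSubLmodule of sub_lie by <:].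

Lemma sub_lieP (u : sub_lie) : S (val u).
Proof. by have /asboolP := valP u. Qed.

Lemma sub_br_subproof (u v : sub_lie) : br (val u) (val v) \in sub_pred lieS.
Proof.
have [_ Sbr _ _ _] := lieS.
by apply/asboolP/Sbr; exact: sub_lieP.
Qed.

Definition sub_br (u v : sub_lie) : sub_lie :=
  exist (fun x => x \in sub_pred lieS) _ (sub_br_subproof u v).

Lemma sub_lie_algebra : lie_algebra sub_br (@whole sub_lie).
Proof.
have [_ _ Sbi Salt Sjac] := lieS.
have SP := sub_lieP.
split=> //.
- move=> a u v w _ _ _.
  have [E1 E2] := Sbi a _ _ _ (SP u) (SP v) (SP w).
  by split; apply: val_inj.
- by move=> u _; apply: val_inj; exact: Salt.
- move=> u v w _ _ _; apply: val_inj.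
  exact: Sjac.
Qed.
End LieSubalgebraType.

Section FreeLie.
Variables (g : lmodType rat) (brg : g -> g -> g) (sigma : nat -> g).
Hypothesis hfree : free_lie_algebra brg sigma.

Lemma free_lie_extend (V : lmodType rat) (br : V -> V -> V) (S : V -> Prop)
    (x : nat -> V) : lie_algebra br S -> (forall k, S (x k)) ->
  exists2 f : g -> V, lie_hom brg br (@whole g) S f & forall k, f (sigma k) = x k.
Proof.
move=> lieS Sx.
have x_in k : x k \in sub_pred lieS by exact/asboolP.
have [[f [[_ f_lin f_br] f_sigma]] _] :=
  hfree.2 _ _ (fun k => exist (fun y => y \in sub_pred lieS) _ (x_in k) : sub_lie lieS) (sub_lie_algebra lieS).
exists (fun y => val (f y)); last by move=> k; rewrite f_sigma.
split=> [u _|a u v _ _|u v _ _]; first exact: sub_lieP.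
  by rewrite f_lin // linearP.
by rewrite f_br.
Qed.

(** The map extending [sigma] into the generated subalgebra, followed by the inclusion, is the
    identity by uniqueness. *)
Lemma free_lie_generated x : generated brg (fun v => exists k, v = sigma k) x.
Proof.
set G := generated _ _.
have [[_ _] gbr gbi galt gjac] := hfree.1.
have lieG : lie_algebra brg G.
  split; [split | | by move=> *; apply: gbi | by move=> *; apply: galt
         | by move=> *; apply: gjac].
  - exact: generated_0.
  - exact: generated_lin.
  - exact: generated_br.
have G_sigma k : G (sigma k) by apply: generated_in; exists k.
have [f [f_in f_lin f_br] f_sigma] := @free_lie_extend _ _ _ sigma lieG G_sigma.
suff <- : f x = x by apply: f_in.
have [_ uniq] := hfree.2 _ _ sigma hfree.1.
by apply: (uniq f id) => //; split.
Qed.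

(** By induction on generation rather than by the universal property, because [br] is not assumed to
    be a Lie bracket on all of [V]. *)
Lemma free_lie_hom_ext (V : lmodType rat) (br : V -> V -> V) (S T : V -> Prop)
    (f f' : g -> V) :
  lie_hom brg br (@whole g) S f -> lie_hom brg br (@whole g) T f' ->
  (forall k, f (sigma k) = f' (sigma k)) -> f =1 f'.
Proof.
have lin0 R (h : g -> V) : lie_hom brg br (@whole g) R h -> h 0 = 0.
  by move=> [_ h_lin _]; rewrite -[0](addr0 0) -{1}[0](scaler0 _ (-1)) h_lin // scaleN1r addNr.
move=> homf homf' ff' x.
have [_ f_lin f_br] := homf; have [_ f_lin' f_br'] := homf'.
elim: (free_lie_generated x) => [u [k ->] // | | a u v _ IHu _ IHv | u v _ IHu _ IHv].
- by rewrite (lin0 _ _ homf) (lin0 _ _ homf').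
- by rewrite f_lin // f_lin' // IHu IHv.
- by rewrite f_br // f_br' // IHu IHv.
Qed.
End FreeLie.

Lemma lie_hom0 (V W : lmodType rat) brV brW (S : V -> Prop) (T : W -> Prop) f :
  S 0 -> lie_hom brV brW S T f -> f 0 = 0.
Proof.
by move=> S0 [_ f_lin _]; rewrite -[0](addr0 0) -{1}[0](scaler0 _ (-1)) f_lin // scaleN1r addNr.
Qed.

Lemma lie_algebra_ker (V W : lmodType rat) brV brW (S : V -> Prop) (T : W -> Prop) f :
  lie_algebra brV S -> lie_algebra brW T -> lie_hom brV brW S T f ->
  lie_algebra brV (ker_on S f).
Proof.
move=> [[S0 Slin] Sbr Sbi Salt Sjac] [[T0 _] _ _ Talt _] homf.
have f0 := lie_hom0 S0 homf; have [_ f_lin f_br] := homf.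
split; [split=> // | | | | ].
- move=> a u v [Su fu] [Sv fv]; split; first exact: Slin.
  by rewrite f_lin // fu fv scaler0 addr0.
- move=> u v [Su fu] [Sv fv]; split; first exact: Sbr.
  by rewrite f_br // fu fv Talt.
- by move=> a u v w [Su _] [Sv _] [Sw _]; apply: Sbi.
- by move=> u [Su _]; apply: Salt.
- by move=> u v w [Su _] [Sv _] [Sw _]; apply: Sjac.
Qed.

(** * The Lie algebras rbg, sdg and eg *)

(** A class stable under [pbracket], on which [ihara] agrees with [pbracket] and [pi_e] is a
    homomorphism; [depth_class] does the same for [dg_ihara] and [pi_sdg]. *)
Definition block_class (f : polyfam) : Prop :=
  [/\ no_const f, cyclic_fam f & even_degree f].

Definition depth_class (f : polyfam) : Prop :=
  [/\ no_const f, skew_rev_fam f & even_degree f].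

Lemma even_degree_lin a f g :
  even_degree f -> even_degree g -> even_degree (a *: f + g).
Proof.
move=> f_even g_even n m; rewrite mcoeff_msupp polyfamDE polyfamZE mcoeffD mcoeffZ.
have [/f_even //|/memN_msupp_eq0 ->] := boolP (m \in msupp (f n)).
by rewrite mulr0 add0r -mcoeff_msupp => /g_even.
Qed.

Lemma at_vars0 N (s : seq 'I_N.+1) : at_vars 0 s = 0.
Proof. by case: s => [|a s] //; rewrite at_vars_rename raddf0. Qed.

Lemma no_const_lin a f g : no_const f -> no_const g -> no_const (a *: f + g).
Proof. by rewrite /no_const polyfamDE polyfamZE => -> ->; rewrite scaler0 addr0. Qed.

Lemma block_class_subspace : is_subspace block_class.
Proof.
split=> [|a f g [f0 fcyc fev] [g0 gcyc gev]]; split.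
- by [].
- by move=> N s t; rewrite !at_vars0.
- by move=> n m; rewrite msupp0.
- exact: no_const_lin.
- by move=> N s t; rewrite !at_vars_lin fcyc gcyc.
- exact: even_degree_lin.
Qed.

Lemma depth_class_subspace : is_subspace depth_class.
Proof.
split=> [|a f g [f0 frev fev] [g0 grev gev]]; split.
- by [].
- by move=> N s; rewrite !at_vars0 mulr0.
- by move=> n m; rewrite msupp0.
- exact: no_const_lin.
- by move=> N s; rewrite !at_vars_lin frev grev; ring.
- exact: even_degree_lin.
Qed.

Lemma block_class_bracket f g :
  block_class f -> block_class g -> block_class (pbracket f g).
Proof.
move=> [f0 fcyc fev] [g0 gcyc gev]; split.
- exact: no_const_bracket.
- exact: cyclic_fam_bracket.
- exact: even_degree_bracket.
Qed.

Lemma depth_class_bracket f g :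
  depth_class f -> depth_class g -> depth_class (pbracket f g).
Proof.
move=> [f0 frev fev] [g0 grev gev]; split.
- exact: no_const_bracket.
- exact: skew_rev_fam_bracket.
- exact: even_degree_bracket.
Qed.

Lemma block_class_gen c d k : block_class (sym_gen c d k).
Proof.
split; [exact: no_const_sym_gen | exact: cyclic_sym_gen | exact: even_degree_sym_gen].
Qed.

Lemma depth_class_gen c d k : depth_class (sym_gen c d k).
Proof.
split; [exact: no_const_sym_gen | exact: skew_rev_sym_gen | exact: even_degree_sym_gen].
Qed.

Lemma ihara_block f g : block_class f -> block_class g -> ihara f g = pbracket f g.
Proof. by move=> [f0 fcyc _] [g0 gcyc _]; exact: ihara_pbracket. Qed.

Lemma dg_ihara_depth f g :
  depth_class f -> depth_class g -> dg_ihara f g = pbracket f g.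
Proof. by move=> [f0 frev fev] [g0 grev gev]; exact: dg_ihara_pbracket. Qed.

Lemma generated_class (br : polyfam -> polyfam -> polyfam) (C X : polyfam -> Prop) :
    is_subspace C -> (forall f g, C f -> C g -> C (pbracket f g)) ->
    (forall f g, C f -> C g -> br f g = pbracket f g) ->
    (forall f, X f -> C f) ->
  forall f, generated br X f -> C f.
Proof.
move=> [C0 Clin] Cbr brE XC f; elim=> {f}.
- exact: XC.
- exact: C0.
- by move=> a u v _ Cu _ Cv; apply: Clin.
- by move=> u v _ Cu _ Cv; rewrite brE //; apply: Cbr.
Qed.

Lemma generated_lie_algebra (br : polyfam -> polyfam -> polyfam) (C X : polyfam -> Prop) :
    is_subspace C -> (forall f g, C f -> C g -> C (pbracket f g)) ->
    (forall f g, C f -> C g -> br f g = pbracket f g) ->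
    (forall f, X f -> C f) -> (forall f, C f -> no_const f) ->
  lie_algebra br (generated br X).
Proof.
move=> Csub Cbr brE XC C0; have GC := generated_class Csub Cbr brE XC.
have [_ _ Pbi Palt Pjac] := pbracket_lie.
split; [split | | | | ].
- exact: generated_0.
- exact: generated_lin.
- exact: generated_br.
- move=> a u v w /GC Cu /GC Cv /GC Cw.
  have Cuv : C (a *: u + v) by apply: Csub.2.
  by rewrite !brE //; apply: Pbi; apply: C0.
- by move=> u /GC Cu; rewrite brE //; apply/Palt/C0.
- move=> u v w /GC Cu /GC Cv /GC Cw.
  rewrite !(brE v w, brE w u, brE u v) // !brE; try by [|exact: Cbr].
  by apply: Pjac; apply: C0.
Qed.

Lemma rbg_block f : rbg f -> block_class f.
Proof.
apply: generated_class; [exact: block_class_subspace | exact: block_class_bracket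
  | exact: ihara_block | by move=> _ [k _ ->]; rewrite p_genE; exact: block_class_gen].
Qed.

Lemma eg_block f : eg f -> block_class f.
Proof.
apply: generated_class; [exact: block_class_subspace | exact: block_class_bracket
  | exact: ihara_block | by move=> _ [k _ ->]; rewrite e_genE; exact: block_class_gen].
Qed.

Lemma sdg_depth f : sdg f -> depth_class f.
Proof.
apply: generated_class; [exact: depth_class_subspace | exact: depth_class_bracket
  | exact: dg_ihara_depth | by move=> _ [k _ ->]; rewrite phi_genE; exact: depth_class_gen].
Qed.

Lemma rbg_lie : lie_algebra ihara rbg.
Proof.
apply: (generated_lie_algebra block_class_subspace); [exact: block_class_bracket
  | exact: ihara_block | by move=> _ [k _ ->]; rewrite p_genE; exact: block_class_gen
  | by move=> f []].
Qed.

Lemma eg_lie : lie_algebra ihara eg.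
Proof.
apply: (generated_lie_algebra block_class_subspace); [exact: block_class_bracket
  | exact: ihara_block | by move=> _ [k _ ->]; rewrite e_genE; exact: block_class_gen
  | by move=> f []].
Qed.

Lemma sdg_lie : lie_algebra dg_ihara sdg.
Proof.
apply: (generated_lie_algebra depth_class_subspace); [exact: depth_class_bracket
  | exact: dg_ihara_depth | by move=> _ [k _ ->]; rewrite phi_genE; exact: depth_class_gen
  | by move=> f []].
Qed.

Lemma pi_e_lin a f g : pi_e (a *: f + g) = a *: pi_e f + pi_e g.
Proof. by apply: polyfamP => n; rewrite /pi_e linearP. Qed.

Lemma pi_sdg_lin a f g : pi_sdg (a *: f + g) = a *: pi_sdg f + pi_sdg g.
Proof.
apply: polyfamP => n; rewrite /pi_sdg !polyfamDE !polyfamZE linearP.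
by rewrite scalerDr !scalerA mulrC.
Qed.

Lemma pi_e_p_gen k : pi_e (p_gen k) = e_gen k.
Proof.
rewrite p_genE e_genE pi_e_sym_gen; congr (sym_gen _ _ k); rewrite exprS;
  field; by rewrite expf_neq0.
Qed.

Lemma pi_sdg_phi_gen k : pi_sdg (phi_gen k) = e_gen k.
Proof.
apply: polyfamP => n.
rewrite -[LHS]/(2 ^+ n *: pi_e (phi_gen k) n) phi_genE e_genE pi_e_sym_gen.
case: n => [|[|n]]; rewrite /sym_gen /= ?scaler0 //.
by rewrite expr1 scalerDr !scalerA add0r mul1r divff.
Qed.

Lemma generated_pi_hom (br : polyfam -> polyfam -> polyfam) (S : polyfam -> Prop)
    (pi : polyfam -> polyfam) (C X : polyfam -> Prop) :
    (forall f g, C f -> C g -> br f g = pbracket f g) ->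
    (forall f, generated br X f -> C f) ->
    (forall a f g, pi (a *: f + g) = a *: pi f + pi g) ->
    (forall f g, C f -> C g -> pi (pbracket f g) = pbracket (pi f) (pi g)) ->
    (forall f, X f -> eg (pi f)) ->
  lie_hom br ihara (generated br X) eg pi.
Proof.
move=> brE GC pi_lin pi_br piX.
have pi_eg f : generated br X f -> eg (pi f).
  elim=> {f} [u|||u v Gu piu Gv piv]; first exact: piX.
  - have -> : pi 0 = 0.
      by have := pi_lin (-1) 0 0; rewrite scaler0 addr0 scaleN1r addNr.
    exact: generated_0.
  - by move=> a u v _ piu _ piv; rewrite pi_lin; apply: generated_lin.
  - rewrite brE; [|exact: GC..].
    rewrite pi_br; [|exact: GC..].
    by rewrite -ihara_block; [exact: generated_br|exact: eg_block..].
split=> // u v Gu Gv.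
rewrite brE; [|exact: GC..].
rewrite pi_br; [|exact: GC..].
by rewrite -ihara_block //; apply/eg_block/pi_eg.
Qed.

Lemma pi_e_hom : lie_hom ihara ihara rbg eg pi_e.
Proof.
apply: (@generated_pi_hom _ rbg _ block_class); [exact: ihara_block | exact: rbg_block
 | exact: pi_e_lin | by move=> f g [_ _ ?] [_ _ ?]; exact: pi_e_bracket |].
by move=> _ [k k1 ->]; rewrite pi_e_p_gen; apply: generated_in; exists k.
Qed.

Lemma pi_sdg_hom : lie_hom dg_ihara ihara sdg eg pi_sdg.
Proof.
apply: (@generated_pi_hom _ sdg _ depth_class); [exact: dg_ihara_depth | exact: sdg_depth
 | exact: pi_sdg_lin | by move=> f g [_ _ ?] [_ _ ?]; exact: pi_sdg_bracket |].
by move=> _ [k k1 ->]; rewrite pi_sdg_phi_gen; apply: generated_in; exists k.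
Qed.

Lemma free_lie_surjective (g : lmodType rat) (brg : g -> g -> g) (sigma : nat -> g)
    (br : polyfam -> polyfam -> polyfam) (gen : nat -> polyfam) S f :
  S = generated br (fun v => exists2 k, (1 <= k)%N & v = gen k) ->
  lie_algebra brg (@whole g) ->
  lie_hom brg br (@whole g) S f -> (forall k, f (sigma k) = gen k.+1) ->
  surjective_on (@whole g) S f.
Proof.
move=> -> [_ _ _ _ _] homf f_sigma w; have [_ f_lin f_br] := homf.
elim=> {w} [_ [[//|k] _ ->]||a u v _ [x _ <-] _ [y _ <-]|u v _ [x _ <-] _ [y _ <-]].
- by exists (sigma k).
- by exists 0 => //; apply: lie_hom0 homf.
- by exists (a *: x + y); rewrite ?f_lin.
- by exists (brg x y); rewrite ?f_br.
Qed.

(** The maps are [iota] and [rho] after the inverse of [iota]. By the commuting square, [iota]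
    identifies ker(bg -> eg) with the kernel of [pi_sdg \o rho]; as [rho] is onto [sdg], it maps
    that kernel onto ker(sdg -> eg), with kernel ker [rho]. *)
Lemma exact_sequence_of_iso (g : lmodType rat) (brg : g -> g -> g) (sigma : nat -> g)
    (hfree : free_lie_algebra brg sigma) iota rho :
  lie_iso brg ihara (@whole g) rbg iota ->
  (forall k, iota (sigma k) = p_gen k.+1) ->
  lie_hom brg dg_ihara (@whole g) sdg rho ->
  (forall k, rho (sigma k) = phi_gen k.+1) ->
  exists (alpha : g -> polyfam) (beta : polyfam -> polyfam),
    [/\ short_exact_lie
          brg (ker_on (@whole g) rho)
          ihara (ker_on rbg pi_e)
          dg_ihara (ker_on sdg pi_sdg)
          alpha beta,
        forall x : g, ker_on (@whole g) rho x -> alpha x = iota x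
      & forall x : g, ker_on rbg pi_e (iota x) -> beta (iota x) = rho x].
Proof.
move=> [homi injiota surjiota] iota_sigma homr rho_sigma.
have [iota_in iota_lin iota_br] := homi; have [rho_in rho_lin rho_br] := homr.
(* Outside [rbg] the inverse is unconstrained; it only has to be a total function. *)
have inv_ex v : exists x, rbg v -> iota x = v.
  have [/surjiota [x _ <-]|nv] := pselect (rbg v); first by exists x.
  by exists 0.
have [inv invK] := choice inv_ex.
have invE x : inv (iota x) = x.
  by apply: injiota => //; rewrite invK //; exact: iota_in.
have square : pi_e \o iota =1 pi_sdg \o rho.
  have [pe_in pe_lin pe_br] := pi_e_hom; have [ps_in ps_lin ps_br] := pi_sdg_hom.
  apply: (free_lie_hom_ext hfree (br := ihara) (S := eg) (T := eg)).
  - split=> [u _|a u v _ _|u v _ _] /=; first exact/pe_in/iota_in.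
      by rewrite iota_lin // pe_lin //; exact: iota_in.
    by rewrite iota_br // pe_br //; exact: iota_in.
  - split=> [u _|a u v _ _|u v _ _] /=; first exact/ps_in/rho_in.
      by rewrite rho_lin // ps_lin //; exact: rho_in.
    by rewrite rho_br // ps_br //; exact: rho_in.
  - by move=> k /=; rewrite iota_sigma rho_sigma pi_e_p_gen pi_sdg_phi_gen.
have rbgE v : rbg v -> exists2 x, iota x = v & inv v = x.
  by move=> /surjiota [x _ <-]; exists x.
exists iota, (rho \o inv); split=> //=; last by move=> x _; rewrite invE.
split.
- split; [exact: (lie_algebra_ker hfree.1 sdg_lie homr)
         |exact: (lie_algebra_ker rbg_lie eg_lie pi_e_hom)
         |exact: (lie_algebra_ker sdg_lie eg_lie pi_sdg_hom)].
- split; split.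
  + move=> u [_ rho_u]; split; first exact: iota_in.
    by have := square u; rewrite /= rho_u (lie_hom0 _ pi_sdg_hom) //; exact: generated_0.
  + by move=> a u v _ _; exact: iota_lin.
  + by move=> u v _ _; exact: iota_br.
  + move=> v [/rbgE [x <- /= ->]] pi_x; split; first exact: rho_in.
    by rewrite -[LHS](square x).
  + move=> a u v [/rbgE [x <- _] _] [/rbgE [y <- _] _] /=.
    by rewrite -iota_lin // !invE rho_lin.
  + move=> u v [/rbgE [x <- _] _] [/rbgE [y <- _] _] /=.
    by rewrite -iota_br // !invE rho_br.
- by move=> u v _ _; exact: injiota.
- move=> v [/rbgE [x <- _] pi_x] /=; rewrite invE; split=> [rho_x|[y [_ rho_y]]].
    by exists x.
  by move=> /injiota <-.
- move=> w [sdg_w pi_w].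
  have [x _ rho_x] := free_lie_surjective erefl hfree.1 homr rho_sigma sdg_w.
  exists (iota x); last by rewrite /= invE.
  by split; [exact: iota_in | rewrite [LHS](square x) /= rho_x].
Qed.

(** * Linear independence modulo 2 *)

(* Up to the factor p_scale k, the coefficients of p_(2k+1) are the integers
   p_coef k i; modulo 2 those with i even vanish and p_coef k 1 is odd. *)
Definition p_coef (k i : nat) : nat :=
  (if odd i then (2 ^ k.*2 - 1) * ('C(k.*2, i) %/ 2 ^ logn 2 k.*2)
  else 2 ^ (k.*2 - logn 2 k.*2) * 'C(k.*2, i))%N.

Definition p_scale (k : nat) : rat := 2 ^+ (logn 2 k.*2).+1 / 2 ^+ k.*2.

Lemma p_scale_neq0 k : p_scale k != 0.
Proof. by rewrite mulf_neq0 ?invr_eq0 ?expf_neq0. Qed.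

Lemma logn_double_lt k : (0 < k)%N -> (logn 2 k.*2 < k.*2)%N.
Proof. by move=> k0; apply: ltn_logl; rewrite double_gt0. Qed.

Lemma even_p_coef k i : (0 < k)%N -> ~~ odd i -> ~~ odd (p_coef k i).
Proof.
move=> k0 i_even; rewrite /p_coef (negbTE i_even) oddM oddX.
by rewrite orbF subn_eq0 leqNgt logn_double_lt.
Qed.

(** The coefficient is 2^(2k) - 1 times the odd part of 2k. *)
Lemma odd_p_coef1 k : (0 < k)%N -> odd (p_coef k 1).
Proof.
move=> k0; rewrite /p_coef /= bin1 oddM oddB ?expn_gt0 // oddX double_eq0.
rewrite eqn0Ngt k0 /=.
have k2 : (0 < k.*2)%N by rewrite double_gt0.
apply: contraTT (ltnSn (logn 2 k.*2)); rewrite -dvdn2 -leqNgt => quot_even.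
rewrite -pfactor_dvdn // -{2}(divnK (pfactor_dvdnn 2 k.*2)) expnS.
by rewrite dvdn_mul.
Qed.

(** From i C(2k, i) = 2k C(2k-1, i-1), where i is prime to 2. *)
Lemma dvdn_bin_odd k i : odd i -> (2 ^ logn 2 k.*2 %| 'C(k.*2, i))%N.
Proof.
case: i => // i i_odd; rewrite -(@Gauss_dvdr _ i.+1).
  by rewrite -mul_bin_diag dvdn_mulr // pfactor_dvdnn.
by rewrite coprimeXl // coprime2n.
Qed.

Section BlockWords.
Variables (T : Type) (R : comNzRingType) (X : T -> R).

(** Written over any commutative ring, so that one integral expression maps both to the rationals
    and to ['F_2]. *)
Definition p_list (k : nat) (s : seq T) : R :=
  if s is [:: a; b] then
    \sum_(i < k.*2.+1) (p_coef k i)%:R * (X b ^+ (k.*2 - i) * X a ^+ i)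
  else 0.

Definition z_list (s : seq T) : R := if s is [:: a] then X a else 0.

Definition word_list (w : seq nat) : seq T -> R :=
  foldr (fun k G => der (p_list k.+1) G) z_list w.

Lemma word_list_size w s : size s != (size w).+1 -> word_list w s = 0.
Proof.
elim: w s => [|k w IHw] s /=; first by case: s => [|a []].
move=> sz; rewrite der_expand' -[RHS](dec0 _ s); apply: eq_dec => u [|a r] E //.
rewrite -[RHS](dec0 _ r); apply: eq_dec => v t Er.
case: v Er => [|b [|x v]] Er /=; rewrite ?mul0r //.
by rewrite !IHw ?subrr ?mulr0 // -?E -?Er; apply: contra sz;
  rewrite -E -Er !size_cat /= => /eqP; lia.
Qed.
End BlockWords.

Lemma word_list_morph (T U : Type) (R S : comNzRingType) (f : {rmorphism R -> S})
    (g : T -> U) (X : T -> R) (Y : U -> S) w s :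
  (forall a, f (X a) = Y (g a)) ->
  f (word_list X w s) = word_list Y w (map g s).
Proof.
move=> XY; elim: w s => [|k w IHw] s.
  by case: s => [|a [|b s]] /=; rewrite ?raddf0.
apply: der_morph => // r; case: r => [|a [|b [|c r]]] /=; rewrite ?raddf0 //.
rewrite raddf_sum; apply: eq_bigr => i _.
by rewrite /= !rmorphM !rmorphXn rmorph_nat !XY.
Qed.

Definition word_fam (w : seq nat) : polyfam :=
  foldr (fun k f => pder (p_gen k.+1) f) z_fam w.

Definition word_scale (w : seq nat) : rat := \prod_(k <- w) p_scale k.+1.

Lemma word_scale_neq0 w : word_scale w != 0.
Proof. by rewrite prodf_seq_neq0; apply/allP => k _; exact: p_scale_neq0. Qed.

Lemma at_vars_p_gen N k (s : seq 'I_N.+1) :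
  at_vars (p_gen k) s = p_scale k *: p_list (fun i => 'X_i) k s.
Proof.
rewrite p_genE at_vars_sym_gen; case: s => [|a [|b [|c s]]]; rewrite ?scaler0 //=.
rewrite -['X_a - _]opprB expr_doubleN ['X_a + _]addrC (exprDn 'X_b) (exprBn 'X_b).
rewrite !scaler_sumr -big_split; apply: eq_bigr => i _ /=.
rewrite -mulrA; set M := 'X_b ^+ _ * _.
rewrite mulr_natl -!scaler_nat -signr_odd !scalerA.
have [i_odd|i_even] := boolP (odd i).
  rewrite expr1 mulN1r scalerN -scaleNr -scalerDl; congr (_ *: _).
  rewrite /p_coef i_odd natrM natrB ?expn_gt0 // natrX.
  have -> : 'C(k.*2, i)%:R = ('C(k.*2, i) %/ 2 ^ logn 2 k.*2)%:R * 2 ^+ logn 2 k.*2 :> rat.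
    by rewrite -natrX -natrM divnK // dvdn_bin_odd.
  rewrite /p_scale !exprS; field; by rewrite expf_neq0.
rewrite expr0 mul1r -scalerDl; congr (_ *: _).
rewrite /p_coef (negbTE i_even) natrM natrX /p_scale exprS.
have le_n : (logn 2 k.*2 <= k.*2)%N.
  by case: (posnP k) => [->|/logn_double_lt/ltnW].
have -> : 2 ^+ k.*2 = 2 ^+ (k.*2 - logn 2 k.*2) * 2 ^+ logn 2 k.*2 :> rat.
  by rewrite -exprD subnK.
by rewrite exprS; field; rewrite !expf_neq0.
Qed.

Lemma at_vars_word_fam N w (s : seq 'I_N.+1) :
  at_vars (word_fam w) s = word_scale w *: word_list (fun i => 'X_i) w s.
Proof.
elim: w s => [|k w IHw] s; first by rewrite /word_scale big_nil scale1r at_vars_z.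
rewrite /= at_vars_der /word_scale big_cons -/(word_scale w).
have pE r : at_vars (p_gen k.+1) r =
    (p_scale k.+1)%:MP * p_list (fun i : 'I_N.+1 => 'X_i) k.+1 r.
  by rewrite at_vars_p_gen mul_mpolyC.
have wE r : at_vars (word_fam w) r =
    (word_scale w)%:MP * word_list (fun i : 'I_N.+1 => 'X_i) w r.
  by rewrite IHw mul_mpolyC.
rewrite (eq_der s pE wE) der_scalel der_mull.
by rewrite mulrA -mpolyCM mul_mpolyC.
Qed.

Lemma natr_F2 n : n%:R = (odd n)%:R :> 'F_2.
Proof.
rewrite -{1}(odd_double_half n) natrD -muln2 natrM.
by rewrite (_ : 2%:R = 0 :> 'F_2) ?mulr0 ?addr0 //; exact: val_inj.
Qed.

Section ModTwo.
Variable n : nat.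
Local Notation P := {mpoly 'F_2[n]}.
Local Notation X := (fun i : 'I_n => 'X_i : P).
Implicit Types (p q : P) (m : 'X_{1..n}) (a b x y : 'I_n).

Definition free_of b p : Prop := forall m, m \in msupp p -> m b = 0%N.

Lemma free_ofP b p m : free_of b p -> p@_m != 0 -> m b = 0%N.
Proof. by rewrite -mcoeff_msupp => H /H. Qed.

Lemma free_of0 b : free_of b 0.
Proof. by move=> m; rewrite msupp0. Qed.

Lemma free_ofD b p q : free_of b p -> free_of b q -> free_of b (p + q).
Proof.
by move=> fp fq m /msuppD_le; rewrite mem_cat => /orP[/fp|/fq].
Qed.

Lemma free_ofM b p q : free_of b p -> free_of b q -> free_of b (p * q).
Proof.
move=> fp fq m /msuppM_le /allpairsP [[m1 m2] /= [/fp m1b /fq m2b ->]].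
by rewrite mnmDE m1b m2b.
Qed.

Lemma free_ofN b p : free_of b p -> free_of b (- p).
Proof. by move=> fp m; rewrite (perm_mem (msuppN p)) => /fp. Qed.

Lemma free_ofX b a : a != b -> free_of b 'X_a.
Proof.
by move=> ab m; rewrite msuppX inE => /eqP ->; rewrite mnm1E (negbTE ab).
Qed.

Lemma free_ofXn b p k : free_of b p -> free_of b (p ^+ k).
Proof.
move=> fp; elim: k => [|k IHk]; last by rewrite exprS; apply: free_ofM.
by move=> m; rewrite expr0 msupp1 inE => /eqP ->; rewrite mnm0E.
Qed.

Lemma free_of_dec b (s : seq 'I_n) phi :
  (forall u v, u ++ v = s -> free_of b (phi u v)) -> free_of b (dec s phi).
Proof.
elim: s phi => [|a s IHs] phi fphi /=.
  by apply: free_ofD; [exact: fphi | exact: free_of0].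
apply: free_ofD; first exact: fphi.
by apply: IHs => u v E; apply: fphi; rewrite /= E.
Qed.

Lemma free_of_p_list b k s : b \notin s -> free_of b (p_list X k s).
Proof.
case: s => [|x [|y [|z s]]] /=; try by move=> _; exact: free_of0.
rewrite !inE !negb_or eq_sym [b == y]eq_sym => /andP[bx by_].
elim/big_ind: _ => [|p q|i _]; [exact: free_of0 | exact: free_ofD |].
rewrite mulr_natl -scaler_nat -mul_mpolyC; apply: free_ofM.
  by move=> m; rewrite mpoly.msuppC; case: eqP => // _; rewrite inE => /eqP ->; exact: mnm0E.
by apply: free_ofM; apply/free_ofXn/free_ofX.
Qed.

Lemma free_of_word_list b w s : b \notin s -> free_of b (word_list X w s).
Proof.
elim: w s => [|k w IHw] s b_s /=.
  case: s b_s => [|x [|y s]] /=; try by move=> _; exact: free_of0.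
  by rewrite inE eq_sym => /free_ofX.
rewrite der_expand'; apply: free_of_dec => u [|a r] Er; first exact: free_of0.
apply: free_of_dec => v t Evt.
have [bu bav bt] : [/\ b \notin u, b \notin a :: v & b \notin t].
  by move: b_s; rewrite -Er -Evt -cat_cons !mem_cat !negb_or => /and3P[].
apply: free_ofM; first exact: free_of_p_list.
have notin_cons c : c \in a :: v -> b \notin u ++ c :: t.
  move=> c_av; rewrite mem_cat inE !negb_or bu bt andbT /=.
  by apply: contraNneq bav => ->.
apply: free_ofD; first by apply/IHw/notin_cons/mem_head.
by apply/free_ofN/IHw/notin_cons/mem_last.
Qed.

Lemma mcoeffXnM q a i m :
  ('X_a ^+ i * q)@_m = if (i <= m a)%N then q@_(m - U_(a) *+ i)%MM else 0.
Proof.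
rewrite mpolyXn; case: ifPn => [le_i|].
  have le_m : (U_(a) *+ i <= m)%MM.
    apply/mnm_lepP => j; rewrite mulmnE mnm1E.
    by case: eqP => [<-|_]; rewrite ?mul1n ?mul0n.
  by rewrite -{1}(submK le_m) addmC mulrC mcoeffMX.
apply: contraNeq; rewrite -mcoeff_msupp => /msuppM_le /allpairsP [[m1 m2] /= [m1X _ ->]].
move: m1X; rewrite msuppX inE => /eqP ->.
by rewrite mnmDE mulmnE mnm1E eqxx mul1n leq_addr.
Qed.

Lemma mcoeff_p_listM k a b q m : (0 < k)%N ->
  (p_list X k [:: a; b] * q)@_m =
  \sum_(i < k.*2.+1 | odd i) (p_coef k i)%:R * ('X_b ^+ (k.*2 - i) * ('X_a ^+ i * q))@_m.
Proof.
move=> k0; rewrite /= mulr_suml raddf_sum [RHS]big_mkcond /=.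
apply: eq_bigr => i _; rewrite -!mulrA mulr_natl raddfMn /= mulr_natl -mulr_natl.
case: ifPn => [_|i_even]; first by rewrite mulr_natl.
by rewrite natr_F2 (negbTE (even_p_coef k0 i_even)) mul0r.
Qed.

(** Modulo 2 only monomials with both exponents odd survive in [p_list]; [q] contributes no power of
    the variable [b], whose exponent in the product is therefore odd. *)
Lemma mcoeff_p_listM_free_r k a b q m : (0 < k)%N -> a != b -> free_of b q ->
  ~~ odd (m b) -> (p_list X k [:: a; b] * q)@_m = 0.
Proof.
move=> k0 ab fq mb; rewrite mcoeff_p_listM // big1 // => i i_odd.
rewrite mcoeffXnM; case: ifP => le_b; rewrite ?mulr0 //.
rewrite mcoeffXnM; case: ifP => le_a; rewrite ?mulr0 //.
apply/eqP; rewrite mulf_eq0; apply/orP; right.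
apply: contraNT mb => /(free_ofP fq).
rewrite !mnmBE !mulmnE !mnm1E (negbTE ab) eqxx mul0n mul1n subn0 => /eqP.
rewrite subn_eq0 => mb_le; have -> : m b = (k.*2 - i)%N by apply/eqP; rewrite eqn_leq mb_le.
by rewrite oddB -1?ltnS // odd_double i_odd.
Qed.

Lemma mcoeff_p_listM_free_l k a b q m : (0 < k)%N -> a != b -> free_of a q ->
  ~~ odd (m a) -> (p_list X k [:: a; b] * q)@_m = 0.
Proof.
move=> k0 ab fq ma; rewrite mcoeff_p_listM // big1 // => i i_odd.
rewrite mcoeffXnM; case: ifP => le_b; rewrite ?mulr0 //.
rewrite mcoeffXnM; case: ifP => le_a; rewrite ?mulr0 //.
apply/eqP; rewrite mulf_eq0; apply/orP; right.
apply: contraNT ma => /(free_ofP fq).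
move: le_a; rewrite !mnmBE !mulmnE !mnm1E eqxx mul1n eq_sym (negbTE ab) mul0n subn0.
move=> le_a /eqP; rewrite subn_eq0 => ma_le.
by have -> : m a = i by apply/eqP; rewrite eqn_leq ma_le.
Qed.

(** The exponent 1 at [a] forces i = 1, and that coefficient is odd. *)
Lemma mcoeff_p_listM_lead k a b q m : (0 < k)%N -> a != b -> free_of a q ->
  m a = 1%N ->
  (p_list X k [:: a; b] * q)@_m =
  if (k.*2 - 1 <= m b)%N then q@_(m - U_(b) *+ (k.*2 - 1) - U_(a))%MM else 0.
Proof.
move=> k0 ab fq ma; rewrite mcoeff_p_listM //.
have lt1 : (1 < k.*2.+1)%N by rewrite ltnS double_gt0.
rewrite (bigD1 (Ordinal lt1)) //= [X in _ + X]big1 ?addr0.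
  rewrite natr_F2 odd_p_coef1 // mul1r mcoeffXnM; case: ifP => // _.
  rewrite mcoeffXnM mnmBE mulmnE mnm1E eq_sym (negbTE ab) mul0n subn0 ma.
  by rewrite mulm1n.
move=> i /andP[i_odd i1].
rewrite mcoeffXnM; case: ifP => le_b; rewrite ?mulr0 //.
rewrite mcoeffXnM; case: ifP => le_a; rewrite ?mulr0 //.
move: le_a i1; rewrite mnmBE mulmnE mnm1E eq_sym (negbTE ab) mul0n subn0 ma.
case: i i_odd {le_b} => [[|[|i]] lt_i] //=.
Qed.

Lemma mcoeff_der_p_list k (G : seq 'I_n -> P) x y s m : (0 < k)%N ->
    (forall b r, b \notin r -> free_of b (G r)) ->
    uniq (x :: y :: s) -> m x = 1%N -> {in y :: s, forall a, ~~ odd (m a)} ->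
  (der (p_list X k) G (x :: y :: s))@_m =
  if (k.*2 - 1 <= m y)%N
  then (G (y :: s))@_(m - U_(y) *+ (k.*2 - 1) - U_(x))%MM else 0.
Proof.
move=> k0 Gfree uniq_s mx m_even.
have [xy [xs ys]] : x != y /\ x \notin s /\ y \notin s.
  by move: uniq_s; rewrite /= inE negb_or => /andP[/andP[-> ->] /andP[-> _]].
have oppF2 (c : 'F_2) : - c = c.
  by case: c => [[|[|c]] lt_c] //; exact: val_inj.
rewrite [der _ _ _]/= raddfD /= [X in _ + X](_ : _ = 0) ?addr0.
  rewrite mul0r add0r dec_behead raddfD /= [X in _ + X](_ : _ = 0) ?addr0.
    rewrite mulrBr raddfB /= mcoeff_p_listM_free_r //; last first.
    - by apply: m_even; rewrite mem_head.
    - by apply: Gfree; rewrite inE negb_or eq_sym xy.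
    rewrite sub0r mcoeff_p_listM_lead //; last by apply: Gfree; rewrite inE negb_or xy.
  rewrite (dec_morph (@mcoeff _ _ m)) -[RHS](dec0 _ s); apply: eq_dec => [[|c v]] t _.
    by rewrite raddf0.
  by rewrite mul0r raddf0.
rewrite -[_ + _]/(der (p_list X k) (fun r => G (x :: r)) (y :: s)) der_expand'.
rewrite (dec_morph (@mcoeff _ _ m)) -[RHS](dec0 _ (y :: s)); apply: eq_dec => u [|a r] Er.
  by rewrite raddf0.
rewrite (dec_morph (@mcoeff _ _ m)) -[RHS](dec0 _ r); apply: eq_dec => v t Evt.
case: v Evt => [|b [|c v]] Evt; try by rewrite /= mul0r mcoeff0.
have : uniq (x :: u ++ [:: a, b & t]) by move: uniq_s; rewrite -Er -Evt.
rewrite /= cat_uniq mem_cat negb_or /= !inE !negb_or.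
move=> /andP[/and4P[xu xa xb xt] /and3P[_ /and3P[au bu _] /and3P[/andP[ab at_] bt _]]].
have m_a : ~~ odd (m a) by apply: m_even; rewrite -Er mem_cat inE eqxx orbT.
have m_b : ~~ odd (m b) by apply: m_even; rewrite -Er -Evt mem_cat !inE eqxx !orbT.
rewrite mulrBr raddfB /= mcoeff_p_listM_free_r ?mcoeff_p_listM_free_l ?subrr //.
  by apply: Gfree; rewrite inE mem_cat inE !negb_or [a == x]eq_sym xa au ab at_.
by apply: Gfree; rewrite inE mem_cat inE !negb_or [b == x]eq_sym xb bu eq_sym ab bt.
Qed.
End ModTwo.

Definition lexle (w w' : seq nat) : bool := ((w : seqlexi nat) <= w')%O.

(* The exponents of the monomial z_0 z_1^(2 (k_1 + 1)) ... z_n^(2 (k_n + 1)),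
   the variables being the letters of s. *)
Definition word_monomial n (s : seq 'I_n) (w : seq nat) (m : 'X_{1..n}) : Prop :=
  [/\ forall b, b \notin s -> m b = 0%N,
      forall b, m (head b s) = 1%N
    & forall b i, (i < size w)%N -> m (nth b s i.+1) = (nth 0%N w i).+1.*2].

(** Put K = k + 1 and K' = k' + 1. The first operator takes x y^(2K-1) out of a monomial with
    y^(2K'), which is impossible for K > K'. For K < K' the order is already decided; for K = K' the
    exponent 1 remains at y, which becomes the front variable of the shorter word. *)
Lemma word_list_triangular n (w w' : seq nat) (s : seq 'I_n) m :
  size s = (size w).+1 -> size w' = size w -> uniq s -> word_monomial s w' m ->
  (((word_list (fun i => 'X_i : {mpoly 'F_2[n]}) w s)@_m != 0) -> lexle w w') /\
  (w = w' -> (word_list (fun i => 'X_i : {mpoly 'F_2[n]}) w s)@_m != 0).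
Proof.
elim: w w' s m => [|k w IHw] [|k' w'] // [|x s] m //.
  case: s => // _ _ _ [m0 m1 _]; split=> // _ /=.
  rewrite mcoeffX (_ : _ == m) ?oner_eq0 //; apply/eqP/mnmP => j.
  rewrite mnm1E; case: eqP => [<-|/eqP xj]; first by rewrite (m1 x).
  by rewrite m0 // inE eq_sym.
case: s => // y s [sz] [sz'] uniq_s [m0 m1 m2].
have mx : m x = 1%N := m1 x.
have my : m y = k'.+1.*2 by apply: (m2 x 0%N).
have m_even : {in y :: s, forall a, ~~ odd (m a)}.
  move=> a a_s; rewrite -(nth_index x a_s) -[nth _ _ _]/(nth x (x :: y :: s) (index a (y :: s)).+1).
  rewrite m2 ?odd_double //.
  by move: a_s; rewrite -index_mem /= sz sz'.
have xy : x != y by move: uniq_s; rewrite /= inE negb_or => /andP[/andP[]].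
rewrite /= -/(word_list _ w) mcoeff_der_p_list //; last first.
  by move=> b r; exact: free_of_word_list.
rewrite my; set m' := (_ - _ - _)%MM.
have mE (kk : k = k') : word_monomial (y :: s) w' m'.
  split.
  - move=> b b_s; rewrite /m' !mnmBE mulmnE !mnm1E.
    have [<-|bx] := eqVneq x b; first by rewrite mx subnAC.
    rewrite m0 // inE eq_sym (negbTE bx); exact: b_s.
  - move=> b; rewrite /= /m' !mnmBE mulmnE !mnm1E eqxx (negbTE xy) my kk.
    rewrite mul1n subn0; lia.
  - move=> b i lt_i /=; have lt_is : (i < size s)%N by move: sz sz'; lia.
    rewrite /m' !mnmBE mulmnE !mnm1E.
    have s_i : nth b s i \in s by exact: mem_nth.
    have -> : (y == nth b s i) = false.
      by apply/negbTE; apply: contraTneq s_i => <-; move: uniq_s => /= /and3P[].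
    have -> : (x == nth b s i) = false.
      apply/negbTE; apply: contraTneq s_i => <-; move: uniq_s => /= /andP[].
      by rewrite inE negb_or => /andP[].
    by rewrite mul0n !subn0 (m2 b i.+1).
have sz1 : size (y :: s) = (size w).+1 by rewrite /= sz.
have uniq1 : uniq (y :: s) by case/andP: uniq_s.
split.
  case: ifP => [le_k|]; last by rewrite eqxx.
  rewrite /lexle Order.SeqLexiOrder.lexi_cons !leEnat.
  have le_kk' : (k <= k')%N by lia.
  rewrite le_kk' /= => nz; apply/implyP => ge_kk'.
  have kk : k = k' by apply/eqP; rewrite eqn_leq le_kk'.
  by have [/(_ nz) le_ww' _] := IHw w' (y :: s) m' sz1 sz' uniq1 (mE kk).
case=> kk ww; rewrite ifT; last by lia.
by have [_] := IHw w' (y :: s) m' sz1 sz' uniq1 (mE kk); apply.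
Qed.

Lemma lexle_min (s : seq (seq nat)) : s != [::] ->
  exists2 w, w \in s & {in s, forall w', lexle w w'}.
Proof.
elim: s => // w [|w' s] IHs _.
  by exists w; rewrite ?mem_head // => v; rewrite inE => /eqP ->; exact: Order.POrderTheory.lexx.
have [//|v v_s v_min] := IHs.
have /orP[le_wv|le_vw] := Order.TotalTheory.le_total (w : seqlexi nat) v.
  exists w; rewrite ?mem_head // => u; rewrite inE => /predU1P[->|/v_min].
    exact: Order.POrderTheory.lexx.
  exact: Order.POrderTheory.le_trans.
exists v; first by rewrite inE v_s orbT.
by move=> u; rewrite inE => /predU1P[->|/v_min].
Qed.

Lemma common_denominator (I : eqType) (s : seq I) (d : I -> rat) :
  exists2 D : int, D != 0 & {in s, forall i, exists z : int, z%:~R = D%:~R * d i}.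
Proof.
elim: s => [|i s [D D0 IHs]]; first by exists 1.
exists (D * denq (d i)); first by rewrite mulf_neq0 ?denq_neq0.
move=> j; rewrite inE => /predU1P[->|/IHs [z zE]].
  by exists (D * numq (d i)); rewrite !intrM numqE; ring.
by exists (z * denq (d i)); rewrite !intrM zE; ring.
Qed.

(** Denominators are cleared, then all values are halved while they are all even; the nonzero value
    at [i0] bounds the number of halvings. *)
Lemma primitive_multiple (I : eqType) (s : seq I) (d : I -> rat) i0 :
  i0 \in s -> d i0 != 0 ->
  exists (mu : rat) (e : I -> int), {in s, forall i, (e i)%:~R = mu * d i} /\
    exists2 i, i \in s & odd `|e i|.
Proof.
move=> i0_s d0.
have [D D0 DE] := common_denominator s d.
suff H N (mu : rat) (e : I -> int) : mu != 0 -> {in s, forall i, (e i)%:~R = mu * d i} ->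
    (`|e i0| <= N)%N ->
    exists (mu : rat) (e : I -> int), {in s, forall i, (e i)%:~R = mu * d i} /\
      exists2 i, i \in s & odd `|e i|.
  have /choice [e eE] : forall i, exists z : int, i \in s -> z%:~R = D%:~R * d i.
    by move=> i; have [/DE [z zE]|_] := boolP (i \in s); [exists z | exists 0].
  by apply: (H _ D%:~R e _ eE (leqnn _)); rewrite intr_eq0.
elim: N mu e => [|N IHN] mu e mu0 eE le_N.
  have := eE _ i0_s; move: le_N; rewrite leqn0 absz_eq0 => /eqP ->.
  by move/eqP; rewrite eq_sym mulf_eq0 (negbTE mu0) (negbTE d0).
have [/hasP [i i_s i_odd]|/hasPn e_even] := boolP (has (fun i => odd `|e i|) s).
  by exists mu, e; split=> //; exists i.
have e2 i : i \in s -> e i = (e i %/ 2)%Z * 2.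
  by move=> /e_even ei_even; rewrite divzK // dvdzE dvdn2.
apply: (IHN (mu / 2) (fun i => (e i %/ 2)%Z)); first by rewrite mulf_neq0.
  move=> i i_s; have := eE i i_s; rewrite {1}(e2 i i_s) intrM => E.
  by rewrite mulrAC -E mulfK.
have : e i0 != 0 by rewrite -(intr_eq0 rat) eE // mulf_neq0.
by move: le_N; rewrite {1 2}(e2 _ i0_s); lia.
Qed.

Lemma at_vars_sum N (I : Type) (s : seq I) (c : I -> rat) (f : I -> polyfam)
    (t : seq 'I_N.+1) :
  at_vars (\sum_(i <- s) c i *: f i) t = \sum_(i <- s) c i *: at_vars (f i) t.
Proof.
elim: s => [|i s IHs]; first by rewrite !big_nil at_vars0.
by rewrite !big_cons at_vars_lin IHs mul_mpolyC.
Qed.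

Lemma intr_F2_neq0 (z : int) : (z%:~R != 0 :> 'F_2) = odd `|z|.
Proof.
have -> : (z%:~R == 0 :> 'F_2) = (`|z|%:R == 0 :> 'F_2).
  by case: z => k; rewrite ?NegzE ?intrN ?oppr_eq0 //= abszN.
by rewrite natr_F2; case: odd.
Qed.

Lemma word_fam_free (ws : seq (seq nat)) (c : seq nat -> rat) :
  uniq ws -> \sum_(w <- ws) c w *: word_fam w = 0 -> {in ws, forall w, c w = 0}.
Proof.
move=> uniq_ws sum0 w0 w0_ws; apply/eqP; apply: contraT => c0.
pose d w := c w * word_scale w.
have d0 : d w0 != 0 by rewrite mulf_neq0 ?word_scale_neq0.
have [mu [e [eE [i i_ws i_odd]]]] := primitive_multiple w0_ws d0.
(* Words of one length are compared, as the others yield families in other numbers of variables.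
   Among those with odd coefficient, the lexicographically least is the only one to reach its own
   monomial. *)
pose odds := [seq w <- ws | odd `|e w|].
have odds0 : odds != [::].
  by apply/eqP => E; have := mem_filter (fun w => odd `|e w|) i ws;
    rewrite i_odd i_ws -/odds E.
have odds_size : [seq w <- odds | size w == size i] != [::].
  by apply/eqP => E; have := mem_filter (fun w => size w == size i) i odds;
    rewrite E eqxx /odds mem_filter i_odd i_ws.
have [v v_in v_min] := lexle_min odds_size.
move: v_in; rewrite !mem_filter => /and3P[/eqP sz_v v_odd v_ws].
pose N := size v; pose s := enum 'I_N.+1.
pose X (R : comNzRingType) (i : 'I_N.+1) : {mpoly R[N.+1]} := 'X_i.
(* The relation over a varying ring: it vanishes over the rationals, hence over the integers, hence
   over ['F_2]. *)
pose S (R : comNzRingType) : {mpoly R[N.+1]} :=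
  \sum_(w <- ws) (e w)%:~R%:MP * word_list (X R) w s.
have morphS (R R' : comNzRingType) (f : {rmorphism R -> R'}) : map_mpoly f (S R) = S R'.
  rewrite raddf_sum; apply: eq_bigr => w _ /=.
  rewrite rmorphM /= map_mpolyC.
  rewrite (@word_list_morph _ _ _ _ (map_mpoly f) id _ (X R')) ?map_id.
    by congr (_%:MP * _); exact: rmorph_int.
  by move=> a; exact: map_mpolyX.
have Srat : S rat = 0.
  have := congr1 (fun f => mu *: at_vars f s) sum0; rewrite at_vars_sum at_vars0 scaler0.
  rewrite scaler_sumr => sum0'; rewrite -[RHS]sum0' /S big_seq [RHS]big_seq.
  apply: eq_bigr => w w_ws; rewrite at_vars_word_fam !scalerA eE // mul_mpolyC.
  by rewrite /d mulrA.
have Sint : S int = 0.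
  have : map_mpoly (intr : int -> rat) (S int) = 0 by rewrite morphS.
  move=> S0; apply/mpolyP => m; apply: (@intr_inj rat).
  by rewrite -mcoeff_map_mpoly S0 !mcoeff0.
have S2 : S ('F_2 : comNzRingType) = 0.
  by rewrite -(morphS int _ (intr : int -> 'F_2)) Sint raddf0.
pose m : 'X_{1..N.+1} := [multinom (if i == ord0 then 1 else (nth 0 v i.-1).+1.*2)%N | i < N.+1].
have s0 : head ord0 s = ord0.
  by apply: val_inj; rewrite -nth0 /= nth_enum_ord.
have mE : word_monomial s v m.
  split.
  - by move=> b; rewrite mem_enum.
  - move=> b; have -> : head b s = ord0.
      by rewrite -s0 /s enum_mkseq.
    by rewrite /m mnmE.
  - move=> b j lt_j; rewrite /m mnmE -(inj_eq val_inj) /= nth_enum_ord //=.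
have := congr1 (mcoeff m) S2; rewrite mcoeff0 /S raddf_sum /= (bigD1_seq v) //=.
rewrite big1_seq ?addr0.
  rewrite mcoeffCM => /eqP; rewrite mulf_eq0 -[_ == 0]negbK intr_F2_neq0 v_odd /=.
  have [_ /(_ erefl) /negbTE -> //] := @word_list_triangular _ v v s m
    (size_enum_ord _) erefl (enum_uniq _) mE.
move=> w /andP[wv w_ws]; rewrite mcoeffCM.
have [w_odd|w_even] := boolP (odd `|e w|); last first.
  by move: w_even; rewrite -intr_F2_neq0 negbK => /eqP ->; rewrite mul0r.
have [sz|sz] := eqVneq (size w) N; last first.
  by rewrite word_list_size ?mcoeff0 ?mulr0 // size_enum_ord eqSS eq_sym.
apply/eqP; rewrite mulf_eq0; apply/orP; right; apply: contraNT wv => nz.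
have [/(_ nz) le_wv _] := @word_list_triangular _ w v s m
  (etrans (size_enum_ord _) (congr1 succn (esym sz))) (esym sz) (enum_uniq _) mE.
have le_vw : lexle v w.
  by apply: v_min; rewrite !mem_filter w_odd w_ws sz -/N -sz_v eqxx.
have wv : (w : seqlexi nat) = v.
  by apply: Order.POrderTheory.le_anti; apply/andP; split; [exact: le_wv | exact: le_vw].
by apply/eqP.
Qed.

(** * Injectivity of iota *)

Definition commutator (A : algType rat) (x y : A) : A := x * y - y * x.

Lemma commutator_lie (A : algType rat) : lie_algebra (@commutator A) (@whole A).
Proof.
split=> //.
- move=> a u v w _ _ _; rewrite /commutator !mulrDl !mulrDr -!scalerAl -!scalerAr.
  by split; rewrite scalerBr opprD addrACA.
- by move=> u _; exact: subrr.
- move=> u v w _ _ _; rewrite /commutator !mulrBl !mulrBr !mulrA !opprB.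
  have tele (x y z : A) : (x - y) + (y - z) = x - z by rewrite addrA subrK.
  rewrite [X in _ + X + _]addrC (addrACA (u * v * w - u * w * v)) tele.
  rewrite (addrACA (u * v * w - w * u * v)).
  by rewrite !tele subrr.
Qed.

(** * The free associative algebra and linear extension from words *)

Lemma malg_scaleAr (K : monomType) (R : comNzRingType) (c : R) (x y : malg K R) :
  c *: (x * y) = x * (c *: y).
Proof.
apply/malgP => k; rewrite monalg.mcoeffZ mcoeffMl.
rewrite (mcoeffMlw _ (finmap.fsubset_refl _) (monalg.msuppZ_le c y)) mulr_sumr.
apply: eq_bigr => k1 _; rewrite mulr_sumr; apply: eq_bigr => k2 _.
by rewrite monalg.mcoeffZ mulrnAr mulrCA.
Qed.

Definition free_assoc : Type := malg (fmonom nat) rat.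
HB.instance Definition _ := GRing.Lalgebra.on free_assoc.

Definition word (w : seq nat) : free_assoc := mkmalgU (FMonom w) 1.

Definition word_coef (t : free_assoc) (w : seq nat) : rat :=
  monalg.mcoeff (FMonom w) t.

Definition words (t : free_assoc) : seq (seq nat) :=
  [seq fmonom_val k | k <- finmap.enum_fset (monalg.msupp t)].

Lemma free_assocE (t : free_assoc) :
  t = \sum_(w <- words t) word_coef t w *: word w.
Proof.
rewrite {1}[t]monalgE big_map; apply: eq_bigr => -[w] _ /=.
apply/malgP => k; rewrite monalg.mcoeffZ !mcoeffU /word_coef /=.
by case: eqP => _; rewrite ?mulr1 ?mulr0.
Qed.

Lemma word_mul u v : word u * word v = word (u ++ v).
Proof.
rewrite /word [LHS]malgM_def fgmulUU mul1r; congr (mkmalgU _ _).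
by apply: val_inj; rewrite /= fmM.
Qed.

HB.instance Definition _ :=
  GRing.Lalgebra_isAlgebra.Build rat free_assoc (@malg_scaleAr _ _).

Section LinearExtension.
Variables (V : lmodType rat).
Implicit Types (b : seq nat -> V) (s t : free_assoc).

Definition word_lift b t : V :=
  \sum_(k <- finmap.enum_fset (monalg.msupp t)) monalg.mcoeff k t *: b (fmonom_val k).

Lemma word_lift_widen b t (d : finmap.finset_of (Phant (fmonom nat))) :
  finmap.fsubset (monalg.msupp t) d ->
  word_lift b t =
  \sum_(k <- finmap.enum_fset d) monalg.mcoeff k t *: b (fmonom_val k).
Proof.
move=> le; rewrite [LHS](finmap.big_fset_incl _ le) => //= x xd /mcoeff_outdom ->.
by rewrite scale0r.
Qed.

Lemma word_lift_lin b a s t : word_lift b (a *: s + t) = a *: word_lift b s + word_lift b t.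
Proof.
pose d := finmap.fsetU (monalg.msupp s) (monalg.msupp t).
have ds : finmap.fsubset (monalg.msupp s) d := finmap.fsubsetUl _ _.
have dt : finmap.fsubset (monalg.msupp t) d := finmap.fsubsetUr _ _.
have dst : finmap.fsubset (monalg.msupp (a *: s + t)) d.
  apply: finmap.fsubset_trans (monalg.msuppD_le _ _) _.
  by apply: finmap.fsetSU; exact: monalg.msuppZ_le.
rewrite (word_lift_widen _ ds) (word_lift_widen _ dt) (word_lift_widen _ dst).
rewrite scaler_sumr -big_split; apply: eq_bigr => k _ /=.
by rewrite monalg.mcoeffD monalg.mcoeffZ scalerDl scalerA.
Qed.

Lemma word_lift_word b w : word_lift b (word w) = b w.
Proof.
rewrite (word_lift_widen _ msuppU_le) finmap.big_seq_fset1 /word.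
by rewrite mcoeffUU scale1r.
Qed.

Lemma free_assoc_ext (f f' : free_assoc -> V) :
  (forall a s t, f (a *: s + t) = a *: f s + f t) ->
  (forall a s t, f' (a *: s + t) = a *: f' s + f' t) ->
  (forall w, f (word w) = f' (word w)) -> f =1 f'.
Proof.
have lin0 (h : free_assoc -> V) : (forall a s t, h (a *: s + t) = a *: h s + h t) -> h 0 = 0.
  by move=> h_lin; have := h_lin (-1) 0 0; rewrite scaler0 addr0 scaleN1r addNr.
move=> f_lin f_lin' ff' t; rewrite [t]free_assocE.
elim: (words _) => [|w s IHs]; first by rewrite big_nil !lin0.
by rewrite big_cons f_lin f_lin' IHs ff'.
Qed.
End LinearExtension.

Lemma word_lift_fam_inj t : word_lift word_fam t = 0 -> t = 0.
Proof.
have -> : word_lift word_fam t = \sum_(w <- words t) word_coef t w *: word_fam w.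
  by rewrite big_map; apply: eq_bigr => -[].
have uniq_words : uniq (words t).
  by rewrite map_inj_uniq ?finmap.fset_uniq //; exact: val_inj.
move=> /(word_fam_free uniq_words) coef0; rewrite [t]free_assocE big_seq big1 //.
by move=> w /coef0 ->; rewrite scale0r.
Qed.

(** * Embedding of the free Lie algebra in the free associative algebra *)

Section Dynkin.
Variables (g : lmodType rat) (brg : g -> g -> g) (sigma : nat -> g).
Hypothesis hfree : free_lie_algebra brg sigma.

(* An abstract copy of free_assoc and of its universal property: unification
   must not unfold the product of free_assoc. *)
Variables (A : algType rat) (word : seq nat -> A).
Variable word_lift : forall V : lmodType rat, (seq nat -> V) -> A -> V.
Hypothesis word_mul : forall u v, word u * word v = word (u ++ v).
Hypothesis word_lift_lin : forall (V : lmodType rat) (b : seq nat -> V) a s t,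
  word_lift b (a *: s + t) = a *: word_lift b s + word_lift b t.
Hypothesis word_lift_word : forall (V : lmodType rat) (b : seq nat -> V) w,
  word_lift b (word w) = b w.
Hypothesis free_assoc_ext : forall (V : lmodType rat) (f f' : A -> V),
  (forall a s t, f (a *: s + t) = a *: f s + f t) ->
  (forall a s t, f' (a *: s + t) = a *: f' s + f' t) ->
  (forall w, f (word w) = f' (word w)) -> f =1 f'.

Let word_lift0 (V : lmodType rat) (b : seq nat -> V) : word_lift b 0 = 0.
Proof. by have := word_lift_lin b (-1) 0 0; rewrite scaler0 addr0 scaleN1r addNr. Qed.

Let word_liftZ (V : lmodType rat) (b : seq nat -> V) a t :
  word_lift b (a *: t) = a *: word_lift b t.
Proof. by have := word_lift_lin b a t 0; rewrite word_lift0 !addr0. Qed.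

Let word_liftB (V : lmodType rat) (b : seq nat -> V) s t :
  word_lift b (s - t) = word_lift b s - word_lift b t.
Proof. by have := word_lift_lin b (-1) t s; rewrite !scaleN1r addrC [RHS]addrC. Qed.

Variable theta : g -> A.
Hypothesis theta_hom : lie_hom brg (@commutator A) (@whole g) (@whole A) theta.
Hypothesis theta_sigma : forall k, theta (sigma k) = word [:: k].

Let theta_lin a x y : theta (a *: x + y) = a *: theta x + theta y.
Proof. by case: theta_hom => _ lin _; exact: lin. Qed.

Let theta_br x y : theta (brg x y) = theta x * theta y - theta y * theta x.
Proof. by case: theta_hom => _ _ br; exact: br. Qed.

Let theta0 : theta 0 = 0.
Proof. by have := theta_lin (-1) 0 0; rewrite scaler0 addr0 scaleN1r addNr. Qed.

Let brg_linl a x y z : brg (a *: x + y) z = a *: brg x z + brg y z.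
Proof. by case: hfree => -[_ _ lin _ _] _; case: (lin a x y z I I I). Qed.

Let brg_linr a x y z : brg z (a *: x + y) = a *: brg z x + brg z y.
Proof. by case: hfree => -[_ _ lin _ _] _; case: (lin a x y z I I I). Qed.

Let brg0r x : brg x 0 = 0.
Proof. by have := brg_linr (-1) 0 0 x; rewrite scaler0 addr0 scaleN1r addNr. Qed.

Let brg0l x : brg 0 x = 0.
Proof. by have := brg_linl (-1) 0 0 x; rewrite scaler0 addr0 scaleN1r addNr. Qed.

Let brg_anti x y : brg y x = - brg x y.
Proof.
have alt z : brg z z = 0 by case: hfree => -[_ _ _ alt _] _; exact: alt.
have := alt (1 *: x + y); rewrite brg_linl !brg_linr.
by rewrite !alt !scale1r add0r addr0 => /eqP; rewrite addrC addr_eq0 => /eqP.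
Qed.

Let brgZr a x y : brg y (a *: x) = a *: brg y x.
Proof. by rewrite -[a *: x]addr0 brg_linr brg0r addr0. Qed.

Let brg_jacobi x y z : brg (brg x y) z = brg x (brg y z) - brg y (brg x z).
Proof.
have jac : brg x (brg y z) + brg y (brg z x) + brg z (brg x y) = 0.
  by case: hfree => -[_ _ _ _ jac] _; exact: jac.
have brgNr a b : brg a (- b) = - brg a b by rewrite -scaleN1r brgZr scaleN1r.
rewrite brg_anti [brg x z]brg_anti brgNr opprK.
by apply/eqP; rewrite eq_sym -addr_eq0 jac.
Qed.

(** Left multiplication through [theta] and [pder] through [iota] both turn brackets into
    commutators, the latter by [pder_bracket]. It remains to compare generators, where one more
    letter in front of a word is one more operator. *)
Lemma theta_act (iota : g -> polyfam) x t :
  lie_hom brg ihara (@whole g) rbg iota ->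
  (forall k, iota (sigma k) = p_gen k.+1) ->
  word_lift word_fam (theta x * t) = pder (iota x) (word_lift word_fam t).
Proof.
move=> homi iota_sigma; have [iota_in iota_lin iota_br] := homi.
elim: (free_lie_generated hfree x) t => [u [k ->] t | t | a u v _ IHu _ IHv t | u v _ IHu _ IHv t].
- rewrite theta_sigma iota_sigma; move: t; apply: free_assoc_ext.
  + by move=> a s t; rewrite mulrDr -scalerAr word_lift_lin.
  + by move=> a s t; rewrite word_lift_lin pder_linr.
  + by move=> w; rewrite word_mul !word_lift_word.
- rewrite theta0 mul0r word_lift0 (lie_hom0 _ homi) //.
  by have := pder_lin (-1) 0 0 (word_lift word_fam t); rewrite scaler0 addr0 scaleN1r addNr.
- by rewrite theta_lin iota_lin // mulrDl -scalerAl word_lift_lin IHu IHv pder_lin.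
- have cu := rbg_block (iota_in u I); have cv := rbg_block (iota_in v I).
  rewrite theta_br iota_br // ihara_block // pder_bracket; [|by case: cu|by case: cv].
  rewrite mulrBl -!mulrA word_liftB; congr (_ - _).
    exact: etrans (IHu _) (congr1 (pder _) (IHv _)).
  exact: etrans (IHv _) (congr1 (pder _) (IHu _)).
Qed.

(** The augmentation, needed because nested bracketing treats the empty word apart. *)
Let eps : A -> rat^o := word_lift (fun w => (w == [::])%:R : rat^o).

Fixpoint nested_bracket (w : seq nat) : g :=
  match w with
  | [::] => 0
  | [:: k] => sigma k
  | k :: w' => brg (sigma k) (nested_bracket w')
  end.

Let rho : A -> g := word_lift nested_bracket.
Let deg : A -> A := word_lift (fun w => (size w)%:R *: word w).
(** On the empty word the inverse of 0 is 0, and the nested bracket is 0 as well. *)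
Let rho' : A -> g := word_lift (fun w => (size w)%:R^-1 *: nested_bracket w).

Let eps_mul s t : eps (s * t) = eps s * eps t.
Proof.
move: s; apply: (free_assoc_ext (V := (rat^o : lmodType rat))) => [a s s'|a s s'|w].
- by rewrite mulrDl -scalerAl /eps word_lift_lin.
- by rewrite /eps word_lift_lin mulrDl scalerAl.
move: t; apply: (free_assoc_ext (V := (rat^o : lmodType rat))) => [a s s'|a s s'|w'].
- by rewrite mulrDr -scalerAr /eps word_lift_lin.
- by rewrite /eps word_lift_lin mulrDr -scalerAr.
rewrite word_mul /eps !word_lift_word.
by case: w w' => [|k w] [|k' w']; rewrite /= ?mulr0 ?mul0r ?mulr1.
Qed.

Let eps_theta x : eps (theta x) = 0.
Proof.
elim: (free_lie_generated hfree x) => [u [k ->] | | a u v _ IHu _ IHv | u v _ IHu _ IHv].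
- by rewrite theta_sigma /eps word_lift_word.
- by rewrite theta0 /eps word_lift0.
- by rewrite theta_lin /eps word_lift_lin -/eps IHu IHv scaler0 addr0.
- by rewrite theta_br /eps word_liftB -/eps !eps_mul IHu IHv mulr0 subrr.
Qed.

(** When [t] is the empty word there is nothing to bracket with, and the augmentation supplies
    [sigma k]. *)
Let rho_letter k t : rho (word [:: k] * t) = brg (sigma k) (rho t) + eps t *: sigma k.
Proof.
move: t; apply: free_assoc_ext => [a s t|a s t|w].
- by rewrite mulrDr -scalerAr /rho word_lift_lin.
- rewrite /rho /eps !word_lift_lin brg_linr scalerDl -/eps scalerDr scalerA.
  by rewrite addrACA.
rewrite word_mul /rho /eps !word_lift_word; case: w => [|k' w] /=.
  by rewrite brg0r add0r scale1r.
by rewrite scale0r addr0.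
Qed.

(** By the Jacobi identity the adjoint action turns brackets into commutators, as left
    multiplication through [theta] does; on generators this is [rho_letter] without its
    correction. *)
Let rho_theta x t : eps t = 0 -> rho (theta x * t) = brg x (rho t).
Proof.
elim: (free_lie_generated hfree x) t => [u [k ->] t t0 | t _ | a u v _ IHu _ IHv t t0 | u v _ IHu _ IHv t t0].
- by rewrite theta_sigma rho_letter t0 scale0r addr0.
- by rewrite theta0 mul0r /rho word_lift0 brg0l.
- by rewrite theta_lin mulrDl -scalerAl /rho word_lift_lin -/rho IHu // IHv // brg_linl.
- rewrite theta_br mulrBl -!mulrA /rho word_liftB -/rho.
  have t0' w : eps (theta w * t) = 0 by rewrite eps_mul t0 mulr0.
  by rewrite brg_jacobi (IHu _ (t0' v)) (IHv _ (t0' u)) (IHu _ t0) (IHv _ t0).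
Qed.

Let deg_mul s t : deg (s * t) = deg s * t + s * deg t.
Proof.
move: s; apply: free_assoc_ext => [a s s'|a s s'|w].
- by rewrite mulrDl -scalerAl /deg word_lift_lin.
- by rewrite /deg word_lift_lin !mulrDl -!scalerAl scalerDr addrACA.
move: t; apply: free_assoc_ext => [a s s'|a s s'|w'].
- by rewrite mulrDr -scalerAr /deg word_lift_lin.
- by rewrite /deg word_lift_lin !mulrDr -!scalerAr scalerDr addrACA.
rewrite word_mul /deg !word_lift_word -scalerAl -scalerAr !word_mul size_cat natrD.
by rewrite scalerDl.
Qed.

Let rho'_deg t : rho' (deg t) = rho t.
Proof.
move: t; apply: free_assoc_ext => [a s t|a s t|w].
- by rewrite /deg word_lift_lin /rho' word_lift_lin.
- by rewrite /rho word_lift_lin.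
rewrite /deg /rho' /rho word_lift_word word_liftZ !word_lift_word scalerA.
case: w => [|k w]; first by rewrite scaler0.
by rewrite mulfV ?scale1r // Num.Theory.pnatr_eq0.
Qed.

(** Dynkin's factor is the degree, so elements must be split into homogeneous ones. A spanning set
    of monomials stands in for a grading of [g]; no uniqueness of degrees is asked for. *)
Inductive lie_monomial : nat -> g -> Prop :=
| lie_monomial1 k : lie_monomial 1 (sigma k)
| lie_monomial_br m n x y :
    lie_monomial m x -> lie_monomial n y -> lie_monomial (m + n) (brg x y).

Inductive lie_span : g -> Prop :=
| lie_span0 : lie_span 0
| lie_span_add a n x y : lie_monomial n x -> lie_span y -> lie_span (a *: x + y).

Let lie_span_lin a x y : lie_span x -> lie_span y -> lie_span (a *: x + y).
Proof.
move=> span_x span_y; elim: span_x => [|b n u v mon_u _ IHv].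
  by rewrite scaler0 add0r.
by rewrite scalerDr scalerA -addrA; apply: lie_span_add mon_u IHv.
Qed.

Let lie_spanP x : lie_span x.
Proof.
elim: (free_lie_generated hfree x) => [u [k ->] | | a u v _ IHu _ IHv | u v _ IHu _ IHv].
- by rewrite -[sigma k]addr0 -[sigma k]scale1r; apply: lie_span_add (lie_monomial1 k) lie_span0.
- exact: lie_span0.
- exact: lie_span_lin.
- elim: IHu => [|a n x1 y1 mon_x1 _ IHy1]; first by rewrite brg0l; exact: lie_span0.
  rewrite brg_linl; apply: lie_span_lin IHy1.
  elim: IHv => [|b m x2 y2 mon_x2 _ IHy2]; first by rewrite brg0r; exact: lie_span0.
  by rewrite brg_linr; apply: lie_span_add IHy2; exact: lie_monomial_br mon_x1 mon_x2.
Qed.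

Let lie_monomialP n x : lie_monomial n x ->
  [/\ (0 < n)%N, deg (theta x) = n%:R *: theta x & rho (theta x) = n%:R *: x].
Proof.
elim=> {n x} [k|m n x y _ [m0 deg_x rho_x] _ [n0 deg_y rho_y]].
  by rewrite theta_sigma /deg /rho !word_lift_word !scale1r.
split; first by rewrite addn_gt0 m0.
  rewrite theta_br /deg word_liftB -/deg !deg_mul deg_x deg_y.
  by rewrite -!scalerAl -!scalerAr natrD scalerBr !scalerDl [X in _ - X]addrC.
(* By [rho_theta] the commutator goes to n [x,y] - m [y,x], which is (m + n) [x,y]. *)
rewrite theta_br /rho word_liftB -/rho !rho_theta // rho_x rho_y !brgZr.
by rewrite [brg y x]brg_anti scalerN opprK natrD scalerDl addrC.
Qed.

(* The Dynkin-Specht-Wever theorem: on a Lie element of degree n, nested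
   bracketing is multiplication by n. *)
Lemma dynkin x : rho' (theta x) = x.
Proof.
elim: (lie_spanP x) => [|a n u v /lie_monomialP [n0 deg_u rho_u] _ IHv].
  by rewrite theta0 /rho' word_lift0.
rewrite theta_lin /rho' word_lift_lin -/rho' IHv; congr (_ *: _ + _).
have nz : n%:R != 0 :> rat by rewrite Num.Theory.pnatr_eq0 -lt0n.
apply: (scalerI nz); rewrite -rho_u -rho'_deg deg_u.
by rewrite /rho' word_liftZ.
Qed.

Lemma theta_inj x : theta x = 0 -> x = 0.
Proof. by rewrite -{2}(dynkin x) => ->; rewrite /rho' word_lift0. Qed.
End Dynkin.

(** Let d be the difference of two elements with the same image. By [theta_act],
    [word_lift word_fam] kills [theta] d times 1; it is injective by linear independence, so [theta]
    d = 0, and d = 0 by [theta_inj]. *)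
Lemma iota_injective (g : lmodType rat) (brg : g -> g -> g) (sigma : nat -> g)
    (iota : g -> polyfam) :
  free_lie_algebra brg sigma -> lie_hom brg ihara (@whole g) rbg iota ->
  (forall k, iota (sigma k) = p_gen k.+1) ->
  injective_on (@whole g) iota.
Proof.
move=> hfree homi iota_sigma x y _ _ eq_xy; have [_ iota_lin _] := homi.
have [theta theta_hom theta_sigma] := free_lie_extend hfree
  (x := fun k => word [:: k]) (@commutator_lie free_assoc) (fun=> I).
have : theta (-1 *: y + x) = 0.
  apply: word_lift_fam_inj; rewrite -[theta _]mulr1.
  rewrite (theta_act hfree word_mul (@word_lift_lin) word_lift_word free_assoc_ext theta_hom
    theta_sigma _ _ homi iota_sigma).
  rewrite iota_lin // eq_xy scaleN1r addNr.
  by have := pder_lin (-1) 0 0 (word_lift word_fam 1); rewrite scaler0 addr0 scaleN1r addNr.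
move/(theta_inj hfree word_mul (@word_lift_lin) word_lift_word free_assoc_ext theta_hom
  theta_sigma)/eqP.
by rewrite scaleN1r addrC subr_eq0 => /eqP.
Qed.

(** Here [sigma k] stands for the generator sigma_(2k+3), whence the shift to [p_gen k.+1] and
    [phi_gen k.+1]. *)
Theorem corollary3p7 (g : lmodType rat) (brg : g -> g -> g) (sigma : nat -> g)
    (hfree : free_lie_algebra brg sigma) :
  exists iota rho : g -> polyfam,
    [/\ lie_iso brg ihara (@whole g) rbg iota /\
          (forall k : nat, iota (sigma k) = p_gen k.+1),
        lie_hom brg dg_ihara (@whole g) sdg rho /\
          (forall k : nat, rho (sigma k) = phi_gen k.+1),
        lie_hom ihara ihara rbg eg pi_e,
        lie_hom dg_ihara ihara sdg eg pi_sdg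
      & exists (alpha : g -> polyfam) (beta : polyfam -> polyfam),
          [/\ short_exact_lie
                brg (ker_on (@whole g) rho)
                ihara (ker_on rbg pi_e)
                dg_ihara (ker_on sdg pi_sdg)
                alpha beta,
              forall x : g, ker_on (@whole g) rho x -> alpha x = iota x
            & forall x : g, ker_on rbg pi_e (iota x) -> beta (iota x) = rho x]].
Proof.
have [|iota homi iota_sigma] := free_lie_extend hfree (x := fun k => p_gen k.+1) rbg_lie.
  by move=> k; apply: generated_in; exists k.+1.
have [|rho homr rho_sigma] := free_lie_extend hfree (x := fun k => phi_gen k.+1) sdg_lie.
  by move=> k; apply: generated_in; exists k.+1.
have isoi : lie_iso brg ihara (@whole g) rbg iota.
  split=> //; first exact: iota_injective hfree homi iota_sigma.
  exact: free_lie_surjective erefl hfree.1 homi iota_sigma.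
exists iota, rho; split=> //; [exact: pi_e_hom | exact: pi_sdg_hom |].
exact: exact_sequence_of_iso hfree _ _ isoi iota_sigma homr rho_sigma.
Qed.
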